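(* Let $k$ be a positive integer and $a\in\mathbb{R}$, and consider the planar system $$\dot u=-v+u\left((u^2+v^2)^{-k}+a\right),\qquad \dot v=u+v\left((u^2+v^2)^{-k}+a\right)$$ (or equivalently, outside the origin, its polynomial version obtained by multiplying the right-hand sides by $(u^2+v^2)^k$). If $a=0$, then every unbounded spiral trajectory $\Gamma$ of the system lying at positive distance from the origin satisfies $$\dim_B\Gamma=\frac{4k}{2k+1},$$ and $\Gamma$ is Minkowski measurable. For all other values $a\neq0$, the box dimension of such trajectories is trivial, i.e. equal to $1$.
   Context: This system is the geometric inversion $u=x/(x^2+y^2)$, $v=y/(x^2+y^2)$ of the Hopf normal form $\dot x=-y-x((x^2+y^2)^k+a)$, $\dot y=x-y((x^2+y^2)^k+a)$. For a nonempty bounded $B\subset\mathbb{R}^2$, with $B_\varepsilon$ its $\varepsilon$-neighbourhood and $|B_\varepsilon|$ its area, $\mathcal M^{*s}(B)=\limsup_{\varepsilon\to0}|B_\varepsilon|/\varepsilon^{2-s}$, $\mathcal M_*^s(B)$ the same with $\liminf$, $\overline{\dim}_BB=\inf\{s:\mathcal M^{*s}(B)=0\}$, $\underline{\dim}_BB=\inf\{s:\mathcal M_*^{s}(B)=0\}$, $\dim_BB$ their common value; $B$ is Minkowski measurable if $\mathcal M_*^d(B)=\mathcal M^{*d}(B)\in(0,\infty)$ for $d=\dim_BB$. For unbounded $A\subset\mathbb{R}^2$ with $0\notin\overline A$, these notions are defined via the bounded set $\Phi(A)$, $\Phi(x)=x/|x|^2$. *)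

(* Defs.v *)
From mathcomp Require Import all_boot all_order all_algebra.
From mathcomp Require Import all_classical all_reals all_analysis.
Set Implicit Arguments. Unset Strict Implicit. Unset Printing Implicit Defensive.
Import Order.TTheory GRing.Theory Num.Theory.
Import numFieldNormedType.Exports.
Local Open Scope classical_set_scope.
Local Open Scope ring_scope.

Section Defs.
Variable R : realType.

Definition area (A : set (R * R)) : \bar R :=
  ((@lebesgue_measure R) \x (@lebesgue_measure R))%E A.

Definition edist (p q : R * R) : R :=
  Num.sqrt ((p.1 - q.1) ^+ 2 + (p.2 - q.2) ^+ 2).

Definition eps_nbhd (B : set (R * R)) (e : R) : set (R * R) :=
  [set p | exists2 q, B q & edist p q < e].

Definition mink_ratio (s : R) (B : set (R * R)) (e : R) : \bar R :=
  (area (eps_nbhd B e) * ((e `^ (2 - s))^-1)%:E)%E.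

Definition upper_mink (s : R) (B : set (R * R)) : \bar R :=
  ereal_inf [set ereal_sup [set mink_ratio s B e | e in `]0, d[ ] | d in `]0, +oo[ ].

Definition lower_mink (s : R) (B : set (R * R)) : \bar R :=
  ereal_sup [set ereal_inf [set mink_ratio s B e | e in `]0, d[ ] | d in `]0, +oo[ ].

Definition upper_box_dim (B : set (R * R)) : \bar R :=
  ereal_inf [set s%:E | s in [set s : R | upper_mink s B = 0%E]].

Definition lower_box_dim (B : set (R * R)) : \bar R :=
  ereal_inf [set s%:E | s in [set s : R | lower_mink s B = 0%E]].

Definition minkowski_measurable (B : set (R * R)) : Prop :=
  exists d : R, upper_box_dim B = d%:E /\ lower_box_dim B = d%:E /\
    lower_mink d B = upper_mink d B /\
    (0 < upper_mink d B)%E /\ (upper_mink d B < +oo)%E.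

Definition inversion (p : R * R) : R * R :=
  (p.1 / (p.1 ^+ 2 + p.2 ^+ 2), p.2 / (p.1 ^+ 2 + p.2 ^+ 2)).

(* box dimensions of an unbounded set A with 0 not in closure A, via Phi(A) *)
Definition upper_box_dim_unb (A : set (R * R)) := upper_box_dim (inversion @` A).
Definition lower_box_dim_unb (A : set (R * R)) := lower_box_dim (inversion @` A).
Definition minkowski_measurable_unb (A : set (R * R)) :=
  minkowski_measurable (inversion @` A).

Definition field_u (k : nat) (a : R) (u v : R) : R :=
  - v + u * (((u ^+ 2 + v ^+ 2) ^+ k)^-1 + a).
Definition field_v (k : nat) (a : R) (u v : R) : R :=
  u + v * (((u ^+ 2 + v ^+ 2) ^+ k)^-1 + a).

Definition monotone_on (J : set R) (f : R -> R) : Prop :=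
  (forall s t, J s -> J t -> s <= t -> f s <= f t) \/
  (forall s t, J s -> J t -> s <= t -> f t <= f s).

Definition unbounded_spiral_trajectory (k : nat) (a : R) (x y : R -> R) (J : set R) : Prop :=
  [/\ is_interval J,
      (forall t, J t -> is_derive t 1 x (field_u k a (x t) (y t)) /\
                        is_derive t 1 y (field_v k a (x t) (y t))),
      (exists theta rho : R -> R,
          [/\ forall t, J t -> 0 < rho t /\ x t = rho t * cos (theta t)
                                          /\ y t = rho t * sin (theta t),
              {within J, continuous theta},
              monotone_on J theta,
              (forall M : R, exists2 t, J t & M < `|theta t|) &
              monotone_on J rho]),
      (forall M : R, exists2 t, J t & M < `|x t| + `|y t|) &
      (exists2 delta : R, 0 < delta & forall t, J t -> delta <= edist (x t, y t) (0, 0))].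

End Defs.

(* Main.v *)
(**
In polar coordinates the system reads [theta' = 1], [p' = 2k (1 + a p)] with
[p = (u^2 + v^2)^k], so the inverted trajectory is the curve
[p(t)^(-1/2k) (cos (t + psi), sin (t + psi))].

For [a = 0], [p] is affine in [t] and this is the spiral [r = f(s) = b s^(-al)],
[al = 1/2k].  Let [e] be small and [sigma] the parameter at which consecutive
turns are [2e] apart, i.e. [-f'(sigma) = e/pi].  On every ray the
[e]-neighbourhood consists, up to lower order terms, of the segment of length
[f(sigma)] and of disjoint intervals of length [2e] around the outer crossings;
hence its [r dr]-mass is [f(sigma)^2/2 + (e/pi) \int^sigma f], of exact order
[sigma^(-2 al)], i.e. [e^(2 al/(1 + al))], uniformly in the angle.  Integrating
over the angle gives the Minkowski content.

For [a <> 0], [1 + a p] is an exponential of [t], so the inverted trajectory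
converges exponentially fast to the origin or to a circle at each unbounded end
of its time interval; cutting at time [log (1/e)] bounds the area of the
[e]-neighbourhood by [O(e log (1/e))].
*)

(* Rays are used instead of planar strips because a bound on [ray_mass] that is uniform in the angle
   becomes an area bound by one integration, for upper and lower estimates alike. The obstacle is
   that a point of a ray may be close to the curve at another angle. Such a point is compared with
   the nearby crossing of its own ray, at the cost of replacing [e] by [e * (1 + 24 / S)], for the
   part of the curve with parameter at least [S]. The remaining arc has finite length and costs
   [O(e)], which is negligible because [al < 1] makes the dimension [2 / (1 + al)] larger than [1].
   The order of limits matters: [S] is fixed first from the required accuracy, then [e] tends to
   [0]; this makes the upper and lower contents equal and not merely comparable. For [a <> 0] the
   logarithm prevents a bound [O(e)] by this method, so the dimension criterion asks for the sharp
   exponent from below only, and from above for every larger exponent. *)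
From HB Require Import structures.
Require Import Defs.
From mathcomp Require Import all_boot all_order all_algebra.
From mathcomp Require Import all_classical all_reals all_analysis.
From mathcomp Require Import measurable_realfun ring lra.
Import Order.TTheory GRing.Theory Num.Theory.
Import numFieldNormedType.Exports.
Local Open Scope classical_set_scope.
Local Open Scope ring_scope.

(* [edist] alone is the extended distance of MathComp-Analysis. *)
Local Notation edist := Defs.edist.

(** * Plane Lebesgue measure in polar coordinates *)

Section planar_measure.
Context {R : realType}.
Local Notation mu := (@lebesgue_measure R).
Local Notation T := (measurableTypeR R).

(** The product sigma-algebra is generated by rectangles, so an open set is written as a countable
    union of squares with rational centre and radius; squares not contained in [U] are replaced by
    [set0]. *)
Lemma box_open_measurable (U : set (R * R)) :
  (forall p, U p -> exists2 e, 0 < e &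
     forall q, `|q.1 - p.1| < e -> `|q.2 - p.2| < e -> U q) ->
  measurable (U : set (T * T)%type).
Proof.
move=> Uo.
pose box (q : rat * rat * rat) : set (T * T)%type :=
  `]ratr q.1.1 - ratr q.2, ratr q.1.1 + ratr q.2[%classic `*`
  `]ratr q.1.2 - ratr q.2, ratr q.1.2 + ratr q.2[%classic.
pose F q := if `[< box q `<=` U >] then box q else set0.
have -> : U = \bigcup_q F q.
  apply/seteqP; split=> [p Up|p [q _]]; last first.
    by rewrite /F; case: ifPn => // /asboolP; exact.
  have [e e0 eU] := Uo _ Up.
  have [d] := @rat_in_itvoo R 0 (e / 2) ltac:(lra).
  rewrite in_itv/= => /andP[d0 de].
  have [q1] := @rat_in_itvoo R (p.1 - ratr d) (p.1 + ratr d) ltac:(lra).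
  rewrite in_itv/= => /andP[q1l q1r].
  have [q2] := @rat_in_itvoo R (p.2 - ratr d) (p.2 + ratr d) ltac:(lra).
  rewrite in_itv/= => /andP[q2l q2r].
  exists (q1, q2, d) => //; rewrite /F; case: ifPn => [_|/asboolP].
    by split; rewrite /= in_itv/=; apply/andP; split; lra.
  case=> x [/= + +]; rewrite !in_itv/= => /andP[x1l x1r] /andP[x2l x2r].
  by apply: eU; rewrite ltr_norml; apply/andP; split; lra.
apply: countable_bigcupT_measurable; first exact/countableP.
move=> q; rewrite /F; case: ifPn => // _.
by apply: measurableX; exact: measurable_itv.
Qed.

Let scale (c : R) : T -> T := fun x => c * x.

Let measurable_scale c : measurable_fun setT (scale c).
Proof. exact: measurable_funM. Qed.

HB.instance Definition _ c := isMeasurableFun.Build _ _ _ _ (scale c)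
  (measurable_scale c).

(** Both sides are measures in [A], so agreement on the intervals []a, b]] suffices. A negative [c]
    pulls such an interval back to [[b / c, a / c[], hence the two cases. *)
Let lebesgue_measure_scale (c : R) (A : set T) : c != 0 -> measurable A ->
  mu A = (`|c|%:E * mu (scale c @^-1` A))%E.
Proof.
move=> c0 mA.
rewrite (_ : (_ * _)%E = mscale `|c|%:nng (pushforward mu (scale c)) A)//.
apply: lebesgue_measure_unique => //= _ [[a b]] _ <-.
rewrite /mscale/= /pushforward.
have [cn|cp] := ltP c 0.
  have -> : scale c @^-1` [set` `]a, b]] = [set` `[b / c, a / c[].
    apply/seteqP; split=> x; rewrite /= !in_itv/= /scale => /andP[? ?];
     apply/andP; split.
      by rewrite ler_ndivrMr// mulrC.
     by rewrite ltr_ndivlMr// mulrC.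
    by rewrite mulrC -ltr_ndivlMr.
  by rewrite mulrC -ler_ndivrMr.
  rewrite !lebesgue_measure_itv/= !lte_fin ltr_ndivrMr// divfK//.
  rewrite ltr0_norm//; case: ifP => _; last by rewrite mule0.
  by rewrite -EFinM; congr EFin; field.
have {cp} cp : 0 < c by rewrite lt_neqAle eq_sym c0.
have -> : scale c @^-1` [set` `]a, b]] = [set` `]a / c, b / c]].
  apply/seteqP; split=> x; rewrite /= !in_itv/= /scale => /andP[? ?];
     apply/andP; split.
      by rewrite ltr_pdivrMr// mulrC.
     by rewrite ler_pdivlMr// mulrC.
    by rewrite mulrC -ltr_pdivrMr.
  by rewrite mulrC -ler_pdivlMr.
rewrite !lebesgue_measure_itv/= !lte_fin ltr_pM2r ?invr_gt0//.
rewrite gtr0_norm//; case: ifP => _; last by rewrite mule0.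
by rewrite -EFinM; congr EFin; field.
Qed.

Lemma ge0_integral_scale (c : R) (D : set T) (f : T -> \bar R) :
  c != 0 -> measurable D -> measurable_fun D f -> (forall x, D x -> 0 <= f x)%E ->
  (\int[mu]_(x in D) f x =
   `|c|%:E * \int[mu]_(x in ( *%R c : T -> T) @^-1` D) f (c * x)%R)%E.
Proof.
move=> c0 mD mf f0.
rewrite (eq_measure_integral (mscale `|c|%:nng (pushforward mu (scale c)))).
  rewrite ge0_integral_mscale//; congr (_ * _)%E.
  rewrite (ge0_integral_pushforward (measurable_scale c))//.
  by move=> x; rewrite inE; exact: f0.
by move=> A mA _; exact: lebesgue_measure_scale.
Qed.

End planar_measure.

Section polar.
Context {R : realType}.
Local Notation mu := (@lebesgue_measure R).
Local Notation T := (measurableTypeR R).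

(** The weight [r] is the Jacobian of polar coordinates, so that integrating over the angle yields
    the area. *)
Definition ray_mass (A : set (R * R)) (phi : R) : \bar R :=
  (\int[mu]_(r in `]0%R, +oo[) (r * \1_A (r * cos phi, r * sin phi))%R%:E)%E.

(* The half-plane [s x > 0] ([s = 1] or [-1]) is parametrised by
   [(x, m) |-> (s x, s x m)], so that polar coordinates with [m = tan theta]
   only need one-dimensional scalings and Tonelli. *)
Definition half_integrand (A : set (R * R)) (s : R) (p : R * R) : \bar R :=
  (Num.max p.1 0 * \1_A (s * p.1, s * p.1 * p.2))%:E.

Lemma measurable_indic_pair d (X : measurableType d) (A : set (T * T)%type)
    (f g : X -> T) : measurable A -> measurable_fun setT f ->
  measurable_fun setT g -> measurable_fun setT (fun x => \1_A (f x, g x) : R).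
Proof.
move=> mA mf mg.
exact: (measurableT_comp (measurable_indic mA) (measurable_fun_pair mf mg)).
Qed.

Lemma measurable_half_integrand (A : set (T * T)%type) (s : R) : measurable A ->
  measurable_fun setT (half_integrand A s : (T * T)%type -> _).
Proof.
move=> mA; apply/measurable_EFinP/measurable_funM.
  by apply: measurable_maxr => //; exact: measurable_fst.
apply: measurable_indic_pair => //.
  by apply: measurable_funM => //; exact: measurable_fst.
apply: measurable_funM; last exact: measurable_snd.
by apply: measurable_funM => //; exact: measurable_fst.
Qed.

Lemma half_integrand_ge0 A s p : (0 <= half_integrand A s p)%E.
Proof. by rewrite lee_fin mulr_ge0// le_max lexx orbT. Qed.

Lemma cos_atan_gt0 (m : R) : 0 < cos (atan m).
Proof. by rewrite cos_gt0_pihalf// atan_gtNpi2 atan_ltpi2. Qed.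

Lemma sin_atan_cos (m : R) : sin (atan m) = cos (atan m) * m.
Proof.
by rewrite -{3}(atanK m) /tan mulrC divfK// gt_eqF// cos_atan_gt0.
Qed.

Lemma sqr_cos_atan (m : R) : cos (atan m) ^+ 2 = (1 + m ^+ 2)^-1.
Proof.
have := cos2Dsin2 (atan m); rewrite sin_atan_cos => h.
have m0 : 0 < 1 + m ^+ 2 by rewrite ltr_pwDl// sqr_ge0.
apply: (mulIf (lt0r_neq0 m0)); rewrite mulVf ?lt0r_neq0// -[RHS]h.
by ring.
Qed.

(** Substituting [x = r * cos (atan m)] turns [x dx] into [cos^2 (atan m) * r dr]. The factor
    [cos^2 (atan m) = 1 / (1 + m^2)] is the derivative of [atan], so together with [dm] it is the
    angular measure. *)
Lemma half_integrand_section (A : set (T * T)%type) (s m : R) :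
  `|s| = 1 -> measurable A ->
  (\int[mu]_x half_integrand A s (x, m) = ((1 + m ^+ 2)^-1)%R%:E *
     \int[mu]_(r in `]0%R, +oo[)
       (r * \1_A (s * (r * cos (atan m)), s * (r * sin (atan m))))%R%:E)%E.
Proof.
move=> s1 mA.
set c := cos (atan m); have c0 : 0 < c by exact: cos_atan_gt0.
transitivity (\int[mu]_(x in `]0%R, +oo[) (x * \1_A (s * x, s * x * m))%R%:E)%E.
  rewrite [RHS]integral_mkcond; apply: eq_integral => x _; rewrite patchE.
  rewrite /half_integrand/=; case: ifPn => [|xD].
    by rewrite inE/= in_itv/= andbT => x0; rewrite max_l// ltW.
  rewrite max_r ?mul0r// leNgt; apply: contra xD => x0.
  by rewrite inE/= in_itv/= x0.
have mf (u v w : R) : measurable_fun setT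
    (fun r : T => (r * \1_A (u * r, v * r * w))%:E).
  apply/measurable_EFinP/measurable_funM => //.
  by apply: measurable_indic_pair => //; do ?exact: measurable_funM.
rewrite (ge0_integral_scale c) ?gt_eqF//=; last 2 first.
  exact: (measurable_funTS (mf s s m)).
  by move=> x; rewrite in_itv/= andbT => x0; rewrite lee_fin mulr_ge0// ltW.
have -> : ( *%R c : T -> T) @^-1` `]0%R, +oo[%classic = `]0%R, +oo[%classic.
  by apply/seteqP; split=> x; rewrite /= !in_itv/= !andbT pmulr_rgt0.
rewrite -sqr_cos_atan -/c expr2 EFinM -muleA gtr0_norm//; congr (_ * _)%E.
rewrite -ge0_integralZl_EFin//.
- apply: eq_integral => r _; rewrite -EFinM; congr EFin.
  rewrite sin_atan_cos -/c -!mulrA (mulrC c r); congr (_ * (_ * \1_A (_, _))).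
  by ring.
- by move=> x; rewrite /= in_itv/= andbT => x0; rewrite lee_fin mulr_ge0// ltW.
- apply/measurable_EFinP/measurable_funTS/measurable_funM => //.
  by apply: measurable_indic_pair => //; do 2 apply: measurable_funM => //.
- exact: ltW.
Qed.

(** For fixed [x > 0] the substitution [y = s * x * m] contributes the factor [x], which is the
    [Num.max] in [half_integrand]; Tonelli then exchanges [x] and [m]. *)
Lemma half_area_polar (A : set (T * T)%type) (s : R) : `|s| = 1 -> measurable A ->
  (\int[mu]_(x in `]0%R, +oo[) \int[mu]_y (\1_A (s * x, y)%R)%:E =
   \int[mu]_m \int[mu]_x half_integrand A s (x, m))%E.
Proof.
move=> s1 mA.
have s0 : s != 0 by rewrite -normr_eq0 s1 oner_eq0.
transitivity (\int[mu]_x \int[mu]_m half_integrand A s (x, m))%E; last first.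
  exact: (fubini_tonelli _ (measurable_half_integrand A s mA) (half_integrand_ge0 A s)).
rewrite integral_mkcond; apply: eq_integral => x _; rewrite patchE.
case: ifPn => [|xD].
  rewrite inE/= in_itv/= andbT => x0.
  rewrite (ge0_integral_scale (s * x))//=; last 2 first.
    by rewrite mulf_neq0// gt_eqF.
    exact/measurable_EFinP/measurable_indic_pair.
  rewrite normrM s1 mul1r gtr0_norm// preimage_setT -ge0_integralZl_EFin//.
  - by apply: eq_integral => m _; rewrite /half_integrand/= max_l// ltW.
  - by apply/measurable_EFinP/measurable_indic_pair => //; exact: measurable_funM.
  - exact: ltW.
apply/esym/integral0_eq => m _; rewrite /half_integrand/=.
rewrite max_r ?mul0r// leNgt; apply: contra xD => x0.
by rewrite inE/= in_itv/= x0.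
Qed.

Lemma ray_mass_ge0 A phi : (0 <= ray_mass A phi)%E.
Proof.
apply: integral_ge0 => r; rewrite /= in_itv/= andbT => r0.
by rewrite lee_fin mulr_ge0// ltW.
Qed.

Lemma polar_integrandE (A : set (T * T)%type) (m : R) : measurable A ->
  (((1 + m ^+ 2)^-1)%R%:E * (ray_mass A (atan m) + ray_mass A (atan m + pi)) =
   \int[mu]_x half_integrand A 1 (x, m) + \int[mu]_x half_integrand A (-1) (x, m))%E.
Proof.
move=> mA; rewrite !half_integrand_section ?normrN ?normr1//.
rewrite ge0_muleDr ?ray_mass_ge0//.
congr (_ * _ + _ * _)%E; apply: eq_integral => r _; rewrite ?mul1r//.
by rewrite cosDpi sinDpi !mulrN !mulN1r.
Qed.

Lemma measurable_polar_integrand (A : set (T * T)%type) : measurable A ->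
  measurable_fun setT (fun m : T => ((1 + m ^+ 2)^-1)%R%:E *
    (ray_mass A (atan m) + ray_mass A (atan m + pi)))%E.
Proof.
move=> mA.
have -> : (fun m : T => ((1 + m ^+ 2)^-1)%R%:E *
    (ray_mass A (atan m) + ray_mass A (atan m + pi)))%E =
  (fun m : T => \int[mu]_x half_integrand A 1 (x, m) +
    \int[mu]_x half_integrand A (-1) (x, m))%E.
  by apply/funext => m; exact: polar_integrandE.
by apply: emeasurable_funD;
  exact: (measurable_fun_fubini_tonelli_G _ (measurable_half_integrand _ _ mA)
    (half_integrand_ge0 _ _)).
Qed.

(** The angles [atan m] sweep the open right half-plane and [atan m + pi] the left one; the vertical
    axis is a null set. *)
Lemma area_polar (A : set (T * T)%type) : measurable A ->
  area A = (\int[mu]_m (((1 + m ^+ 2)^-1)%R%:E *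
              (ray_mass A (atan m) + ray_mass A (atan m + pi))))%E.
Proof.
move=> mA.
have m1 : measurable_fun setT (fun z : (T * T)%type => (\1_A z : R)%:E).
  by apply/measurable_EFinP; exact: measurable_indic.
have mF : measurable_fun setT (fun x : T => \int[mu]_y (\1_A (x, y) : R)%:E)%E.
  exact: (measurable_fun_fubini_tonelli_F _ m1).
have -> : area A = (\int[mu]_x \int[mu]_y (\1_A (x, y))%:E)%E.
  transitivity (\int[(mu \x mu)%E]_z (\1_A z : R)%:E)%E.
    by rewrite integral_indic ?setIT.
  by apply: (fubini_tonelli1 _ m1) => x; rewrite lee_fin.
have mFN : measurable_fun setT (fun x : T => \int[mu]_y (\1_A (- x, y) : R)%:E)%E.
  apply: (measurableT_comp (f := fun x : T => \int[mu]_y (\1_A (x, y) : R)%:E)%E) => //.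
have F0 (x : T) : (0 <= \int[mu]_y (\1_A (x, y) : R)%:E)%E.
  by apply: integral_ge0 => y _; rewrite lee_fin.
have -> : (\int[mu]_x \int[mu]_y (\1_A (x, y) : R)%:E =
    \int[mu]_(x in `]-oo, 0%R] `|` `]0%R, +oo[) \int[mu]_y (\1_A (x, y) : R)%:E)%E.
  by rewrite -setCitvl setUv.
rewrite ge0_integral_setU//=; last 2 first.
- exact: (measurable_funTS mF).
- rewrite disj_set2E; apply/eqP; rewrite -subset0 => x []/=; rewrite !in_itv/= andbT.
  by move=> ?; rewrite ltNge => /negP.
rewrite addeC.
have -> : (\int[mu]_(x in `]-oo, 0%R]) (\int[mu]_y (\1_A (x, y) : R)%:E) =
    \int[mu]_(x in `]0%R, +oo[) (\int[mu]_y (\1_A (- 1 * x, y)%R : R)%:E))%E.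
  transitivity (\int[mu]_(x in `]-oo, 0%R]) (\int[mu]_y (\1_A (- (- x), y)%R : R)%:E))%E.
    by apply: eq_integral => x _; rewrite opprK.
  rewrite -(@ge0_integration_by_substitution0 R (fun x => \int[mu]_y (\1_A (- x, y)%R : R)%:E)%E)//.
    rewrite -integral_itv_obnd_cbnd.
      by apply: eq_integral => x _; apply: eq_integral => y _; rewrite mulN1r.
    by apply: measurable_funTS; exact: mFN.
have -> : (\int[mu]_(x in `]0%R, +oo[) (\int[mu]_y (\1_A (x, y) : R)%:E) =
    \int[mu]_(x in `]0%R, +oo[) (\int[mu]_y (\1_A (1 * x, y)%R : R)%:E))%E.
  by apply: eq_integral => x _; rewrite mul1r.
rewrite !half_area_polar ?normrN ?normr1//.
rewrite -ge0_integralD//; last 4 first.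
- by move=> m _; apply: integral_ge0 => x _; exact: half_integrand_ge0.
- exact: (measurable_fun_fubini_tonelli_G _ (measurable_half_integrand _ _ mA)
    (half_integrand_ge0 _ _)).
- by move=> m _; apply: integral_ge0 => x _; exact: half_integrand_ge0.
- exact: (measurable_fun_fubini_tonelli_G _ (measurable_half_integrand _ _ mA)
    (half_integrand_ge0 _ _)).
by apply: eq_integral => m _; rewrite polar_integrandE.
Qed.

End polar.

(** * From uniform bounds on rays to bounds on areas *)

Section ray_bounds.
Context {R : realType}.
Local Notation mu := (@lebesgue_measure R).
Local Notation T := (measurableTypeR R).

Lemma integral_oneDsqrV : (\int[mu]_m ((1 + m ^+ 2)^-1)%R%:E = (pi : R)%:E)%E.
Proof.
rewrite ge0_symfun_integralT//=.
- rewrite (_ : [set x : R | (0%R <= x)%R] = `[0%R, +oo[%classic).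
    by rewrite integral0y_oneDsqr -EFinM; congr EFin; field.
  by apply/seteqP; split=> x; rewrite /= in_itv/= andbT.
- by move=> x; rewrite invr_ge0 addr_ge0// sqr_ge0.
- exact: continuous_oneDsqrV.
- by move=> x; rewrite /= sqrrN.
Qed.

Lemma measurable_oneDsqrV :
  measurable_fun setT (fun m : T => ((1 + m ^+ 2)^-1 : R)%:E).
Proof.
apply/measurable_EFinP.
exact: (continuous_measurable_fun (@continuous_oneDsqrV R)).
Qed.

Lemma area_le_ray_mass (A : set (T * T)%type) (b : R) : measurable A ->
  (forall phi, ray_mass A phi <= b%:E)%E -> (area A <= (2 * pi * b)%:E)%E.
Proof.
move=> mA Ab; rewrite area_polar//.
have b0 : 0 <= b by rewrite -lee_fin (le_trans _ (Ab 0))// ray_mass_ge0.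
have m2 := measurable_oneDsqrV.
have V0 (x : R) : 0 <= (1 + x ^+ 2)^-1 by rewrite invr_ge0 addr_ge0// sqr_ge0.
apply: (@le_trans _ _ (\int[mu]_m ((2 * b)%:E * ((1 + m ^+ 2)^-1)%:E))%E).
  apply: ge0_le_integral => //.
  - move=> m _; apply: mule_ge0; first by rewrite lee_fin; exact: V0.
    by apply: adde_ge0; exact: ray_mass_ge0.
  - exact: measurable_polar_integrand.
  - exact: emeasurable_funM.
  - move=> m _; rewrite muleC lee_pmul2r//; last first.
      by rewrite lte_fin invr_gt0 ltr_pwDl// sqr_ge0.
    by rewrite (_ : 2 * b = b + b)%R ?EFinD ?leeD//; ring.
rewrite ge0_integralZl_EFin//; last by rewrite mulr_ge0.
  by rewrite integral_oneDsqrV -EFinM lee_fin; lra.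
by move=> x _; rewrite lee_fin.
Qed.

Lemma area_ge_ray_mass (A : set (T * T)%type) (b : R) : measurable A -> 0 <= b ->
  (forall phi, b%:E <= ray_mass A phi)%E -> ((2 * pi * b)%:E <= area A)%E.
Proof.
move=> mA b0 Ab; rewrite area_polar//.
have m2 := measurable_oneDsqrV.
have V0 (x : R) : 0 <= (1 + x ^+ 2)^-1 by rewrite invr_ge0 addr_ge0// sqr_ge0.
apply: (@le_trans _ _ (\int[mu]_m ((2 * b)%:E * ((1 + m ^+ 2)^-1)%:E))%E); last first.
  apply: ge0_le_integral => //.
  - by move=> m _; rewrite mule_ge0 ?lee_fin ?mulr_ge0.
  - exact: emeasurable_funM.
  - exact: measurable_polar_integrand.
  - move=> m _; rewrite muleC lee_pmul2l//; last first.
      by rewrite lte_fin invr_gt0 ltr_pwDl// sqr_ge0.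
    by rewrite (_ : 2 * b = b + b)%R ?EFinD ?leeD//; ring.
rewrite ge0_integralZl_EFin//; last by rewrite mulr_ge0.
  by rewrite integral_oneDsqrV -EFinM lee_fin; lra.
by move=> x _; rewrite lee_fin.
Qed.

Lemma measurable_ray_integrand (A : set (T * T)%type) (phi : R) : measurable A ->
  measurable_fun setT (fun r : T => (r * \1_A (r * cos phi, r * sin phi) : R)%:E).
Proof.
move=> mA; apply/measurable_EFinP/measurable_funM => //.
by apply: measurable_indic_pair => //; exact: measurable_funM.
Qed.

Lemma integral_ray_itv (a b : R) : 0 <= a <= b ->
  (\int[mu]_(r in `]0%R, +oo[) (r * \1_(`]a, b[%classic : set R) r)%R%:E =
   ((b ^+ 2 - a ^+ 2) / 2)%:E)%E.
Proof.
move=> /andP[a0]; rewrite le_eqVlt => /predU1P[->|ab].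
  rewrite subrr mul0r; apply: integral0_eq => r _.
  rewrite indicE memNset ?mulr0//= in_itv/= => /andP[h1 h2].
  by move: (lt_trans h1 h2); rewrite ltxx.
have cF : continuous (fun x : R => x ^+ 2 / 2).
  by move=> x; apply: cvgM; [exact: exprn_continuous|exact: cvg_cst].
transitivity (\int[mu]_(r in `[a, b]) (r : R)%:E)%E; last first.
  rewrite (@continuous_FTC2 _ _ (fun x => x ^+ 2 / 2))//.
  - by rewrite -EFinB; congr EFin; field.
  - by apply: continuous_subspaceT => x; exact: cvg_id.
  - split.
    + by move=> x _; exact: ex_derive.
    + by apply: cvg_at_right_filter; exact: cF.
    + by apply: cvg_at_left_filter; exact: cF.
  - by move=> x _; rewrite derive1E derive_val /GRing.scale/= ; field.
rewrite -integral_itv_bndo_bndc; last exact/measurable_EFinP.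
rewrite -integral_itv_obnd_cbnd; last exact/measurable_EFinP.
rewrite integral_mkcond [RHS]integral_mkcond; apply: eq_integral => r _.
rewrite !patchE indicE.
have [rab|rab] := boolP (r \in (`]a, b[%classic : set R)).
  rewrite mem_set ?mulr1//=; move: rab; rewrite inE/= !in_itv/= andbT => /andP[h _].
  exact: le_lt_trans h.
by rewrite mulr0; case: ifP.
Qed.

Lemma integral_ray_itvs (c : R) (n : nat) (a b : nat -> R) :
  0 <= c -> (forall i, (i < n)%N -> 0 <= a i <= b i) ->
  (\int[mu]_(r in `]0%R, +oo[) ((r * \1_(`]0, c[%classic : set R) r)%R%:E +
      \sum_(i < n) (r * \1_(`]a i, b i[%classic : set R) r)%R%:E) =
   (c ^+ 2 / 2 + \sum_(i < n) (b i ^+ 2 - a i ^+ 2) / 2)%:E)%E.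
Proof.
move=> c0 ab.
rewrite ge0_integralD//.
- rewrite integral_ray_itv ?lexx ?c0// expr0n subr0.
  rewrite ge0_integral_sum//.
  + rewrite EFinD -sumEFin; congr (_ + _)%E.
    by apply: eq_bigr => i _; rewrite integral_ray_itv ?ab.
  + by move=> i; apply/measurable_EFinP/measurable_funM => //; exact: measurable_indic.
  + move=> i r; rewrite /= in_itv/= andbT => r0.
    by rewrite lee_fin mulr_ge0// ltW.
- move=> r; rewrite /= in_itv/= andbT => r0.
  by rewrite lee_fin mulr_ge0// ltW.
- by apply/measurable_EFinP/measurable_funM => //; exact: measurable_indic.
- move=> r; rewrite /= in_itv/= andbT => r0.
  by rewrite sume_ge0// => i _; rewrite lee_fin mulr_ge0// ltW.
- apply: emeasurable_sum => i.
  by apply/measurable_EFinP/measurable_funM => //; exact: measurable_indic.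
Qed.

(** Overlapping intervals are harmless for an upper bound: the sum of the indicators dominates the
    indicator of the union. *)
Lemma ray_mass_le (A : set (T * T)%type) (phi c : R) (n : nat) (a b : nat -> R) :
  measurable A -> 0 <= c -> (forall i, (i < n)%N -> 0 <= a i <= b i) ->
  (forall r, 0 < r -> A (r * cos phi, r * sin phi) ->
     r < c \/ exists2 i, (i < n)%N & a i < r < b i) ->
  (ray_mass A phi <=
     (c ^+ 2 / 2 + \sum_(i < n) (b i ^+ 2 - a i ^+ 2) / 2)%:E)%E.
Proof.
move=> mA c0 ab Aab.
rewrite -integral_ray_itvs//.
apply: ge0_le_integral => //.
- move=> r; rewrite /= in_itv/= andbT => r0.
  by rewrite lee_fin mulr_ge0// ltW.
- exact: (measurable_funTS (measurable_ray_integrand _ _ mA)).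
- apply: emeasurable_funD; last apply: emeasurable_sum => i.
    by apply/measurable_EFinP/measurable_funM => //; exact: measurable_indic.
  by apply/measurable_EFinP/measurable_funM => //; exact: measurable_indic.
- move=> r; rewrite /= in_itv/= andbT => r0.
  rewrite sumEFin -EFinD lee_fin -mulr_sumr -mulrDr ler_pM2l//.
  rewrite [in leLHS]indicE; case: (boolP (_ \in A)) => [|_]; last first.
    by rewrite addr_ge0// sumr_ge0.
  rewrite inE => /(Aab r r0) [rc|[i ni abr]].
    rewrite indicE mem_set/= ?in_itv/= ?r0// lerDl.
    by rewrite sumr_ge0.
  rewrite (bigD1 (Ordinal ni))//= [X in _ + (X + _)]indicE mem_set//=.
  by rewrite addrCA lerDl addr_ge0// sumr_ge0.
Qed.

(** The intervals are numbered inwards, in the order in which the turns of a spiral meet a ray,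
    whence [b j <= a i] for [i < j]. Disjointness keeps the sum of the indicators at most [1]. *)
Lemma ray_mass_ge (A : set (T * T)%type) (phi c : R) (n : nat) (a b : nat -> R) :
  measurable A -> 0 <= c -> (forall i, (i < n)%N -> c <= a i <= b i) ->
  (forall i j, (i < j < n)%N -> b j <= a i) ->
  (forall r, 0 < r < c -> A (r * cos phi, r * sin phi)) ->
  (forall r i, (i < n)%N -> a i < r < b i -> A (r * cos phi, r * sin phi)) ->
  ((c ^+ 2 / 2 + \sum_(i < n) (b i ^+ 2 - a i ^+ 2) / 2)%:E <= ray_mass A phi)%E.
Proof.
move=> mA c0 ab dis Ac Aab.
have ab0 i : (i < n)%N -> 0 <= a i <= b i.
  by move=> /ab/andP[ca ->]; rewrite (le_trans c0).
rewrite -integral_ray_itvs//.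
apply: ge0_le_integral => //.
- move=> r; rewrite /= in_itv/= andbT => r0.
  rewrite adde_ge0//; first by rewrite lee_fin mulr_ge0// ltW.
  by rewrite sume_ge0// => i _; rewrite lee_fin mulr_ge0// ltW.
- apply: emeasurable_funD; last apply: emeasurable_sum => i.
    by apply/measurable_EFinP/measurable_funM => //; exact: measurable_indic.
  by apply/measurable_EFinP/measurable_funM => //; exact: measurable_indic.
- exact: (measurable_funTS (measurable_ray_integrand _ _ mA)).
move=> r; rewrite /= in_itv/= andbT => r0.
rewrite sumEFin -EFinD lee_fin -mulr_sumr -mulrDr ler_pM2l//.
have [rc|cr] := ltP r c.
  rewrite big1; last first.
    move=> i _; rewrite indicE memNset//= in_itv/= => /andP[air _].
    have /andP[+ _] := ab _ (ltn_ord i).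
    by rewrite leNgt (lt_trans air).
  rewrite addr0 [in leRHS]indicE mem_set; last by apply: Ac; rewrite r0.
  by rewrite indicE lern1 leq_b1.
rewrite [X in X + _]indicE memNset/= ?in_itv/= ?ltNge ?cr ?andbF// add0r.
have [[i abr]|nab] := pselect (exists i : 'I_n, a i < r < b i); last first.
  rewrite big1// => i _; rewrite indicE memNset//= in_itv/= => abr.
  by apply: nab; exists i.
rewrite [in leRHS]indicE mem_set; last exact: (Aab r i).
rewrite (bigD1 i)//= big1 ?addr0; first by rewrite indicE lern1 leq_b1.
move=> j ji; rewrite indicE memNset//= in_itv/= => /andP[ajr rbj].
move: abr => /andP[air rbi].
have [ij|ji'|/val_inj ij] := ltngtP i j; last by rewrite ij eqxx in ji.
  have := dis i j; rewrite ij ltn_ord => /(_ isT).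
  by rewrite leNgt (lt_trans air).
have := dis j i; rewrite ji' ltn_ord => /(_ isT).
by rewrite leNgt (lt_trans ajr).
Qed.

End ray_bounds.

(** * Criteria for box dimension and Minkowski measurability *)

Section minkowski_criteria.
Context {R : realType}.
Implicit Types (B : set (R * R)) (s d e : R).

Lemma gt0_powRD (x r s : R) : 0 < x -> x `^ (r + s) = x `^ r * x `^ s.
Proof. by move=> x0; rewrite powRD// (gt_eqF x0) implybT. Qed.

Lemma area_ge0 (A : set (R * R)) : (0 <= area A)%E.
Proof. exact: measure_ge0. Qed.

Lemma mink_ratio_ge0 s B e : (0 <= mink_ratio s B e)%E.
Proof. by rewrite mule_ge0 ?area_ge0// lee_fin invr_ge0 powR_ge0. Qed.

Lemma mink_ratio_le s d B e (C : R) : 0 < e ->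
  (area (eps_nbhd B e) <= (C * e `^ (2 - d))%:E)%E ->
  (mink_ratio s B e <= (C * e `^ (s - d))%:E)%E.
Proof.
move=> e0 h; rewrite /mink_ratio.
have p0 : 0 < e `^ (2 - s) by exact: powR_gt0.
rewrite lee_pdivrMr// -EFinM -mulrA -gt0_powRD//.
by rewrite (_ : s - d + (2 - s) = 2 - d)//; ring.
Qed.

Lemma mink_ratio_ge s d B e (C : R) : 0 < e ->
  ((C * e `^ (2 - d))%:E <= area (eps_nbhd B e))%E ->
  ((C * e `^ (s - d))%:E <= mink_ratio s B e)%E.
Proof.
move=> e0 h; rewrite /mink_ratio.
have p0 : 0 < e `^ (2 - s) by exact: powR_gt0.
rewrite lee_pdivlMr// -EFinM -mulrA -gt0_powRD//.
by rewrite (_ : s - d + (2 - s) = 2 - d)//; ring.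
Qed.

Lemma lower_mink_ge0 s B : (0 <= lower_mink s B)%E.
Proof.
apply: (@le_trans _ _ (ereal_inf [set mink_ratio s B e | e in `]0, 1[ ])).
  by apply: le_ereal_inf_tmp => _ [e _ <-]; exact: mink_ratio_ge0.
by apply: ereal_sup_ubound; exists 1 => //=; rewrite in_itv/= ltr01.
Qed.

Lemma lower_mink_le_upper s B : (lower_mink s B <= upper_mink s B)%E.
Proof.
apply: ge_ereal_sup => _ [d1 /= + <-]; rewrite in_itv/= andbT => d10.
apply: le_ereal_inf_tmp => _ [d2 /= + <-]; rewrite in_itv/= andbT => d20.
pose e := Num.min d1 d2 / 2.
have m0 : 0 < Num.min d1 d2 by rewrite lt_min d10.
have [m1 m2] : Num.min d1 d2 <= d1 /\ Num.min d1 d2 <= d2.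
  by rewrite !ge_min !lexx orbT.
apply: (@le_trans _ _ (mink_ratio s B e)).
  by apply: ereal_inf_lbound; exists e => //=; rewrite in_itv/= /e; apply/andP; split; lra.
by apply: ereal_sup_ubound; exists e => //=; rewrite in_itv/= /e; apply/andP; split; lra.
Qed.

Lemma upper_mink_le s B (d x : R) : 0 < d ->
  (forall e, (0 < e < d)%R -> mink_ratio s B e <= x%:E)%E -> (upper_mink s B <= x%:E)%E.
Proof.
move=> d0 h; apply: (@le_trans _ _ (ereal_sup [set mink_ratio s B e | e in `]0, d[ ])).
  by apply: ereal_inf_lbound; exists d => //=; rewrite in_itv/= d0.
by apply: ge_ereal_sup => _ [e /= + <-]; rewrite in_itv/=; exact: h.
Qed.

Lemma lower_mink_ge s B (d x : R) : 0 < d ->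
  (forall e, (0 < e < d)%R -> x%:E <= mink_ratio s B e)%E -> (x%:E <= lower_mink s B)%E.
Proof.
move=> d0 h; apply: (@le_trans _ _ (ereal_inf [set mink_ratio s B e | e in `]0, d[ ])).
  by apply: le_ereal_inf_tmp => _ [e /= + <-]; rewrite in_itv/=; exact: h.
by apply: ereal_sup_ubound; exists d => //=; rewrite in_itv/= d0.
Qed.

Lemma ereal_inf_threshold (S : set R) (d : R) :
  (forall s, d < s -> S s) -> (forall s, s < d -> ~ S s) ->
  ereal_inf [set s%:E | s in S] = d%:E.
Proof.
move=> Sd nS; apply/eqP; rewrite eq_le; apply/andP; split.
  apply/lee_addgt0Pr => x x0; apply: ereal_inf_lbound.
  by exists (d + x) => //; apply: Sd; rewrite ltrDl.
apply: le_ereal_inf_tmp => _ [s Ss <-]; rewrite lee_fin leNgt.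
by apply/negP => /nS.
Qed.

(** The loss [h] in the upper bound is there to absorb a logarithmic factor. For [s > d], taking [h]
    as half of [s - d] leaves the power [e^h], which tends to [0]; for [s < d] the ratio stays above
    [c], since [e^(s - d) >= 1] when [e < 1]. *)
Lemma box_dim_criterion (d : R) B :
  (exists2 c, (0 < c)%R & exists2 d0, (0 < d0)%R & forall e, (0 < e < d0)%R ->
     (c * e `^ (2 - d))%:E <= area (eps_nbhd B e))%E ->
  (forall h, (0 < h)%R -> exists C, exists2 d0, (0 < d0)%R & forall e, (0 < e < d0)%R ->
     area (eps_nbhd B e) <= (C * e `^ (2 - (d + h)))%:E)%E ->
  upper_box_dim B = d%:E /\ lower_box_dim B = d%:E.
Proof.
move=> [c c0 [d0 d00 lb]] ub.
have up s : d < s -> upper_mink s B = 0%E.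
  move=> ds; apply/eqP; rewrite eq_le; apply/andP; split; last first.
    exact: le_trans (lower_mink_ge0 s B) (lower_mink_le_upper s B).
  pose h := (s - d) / 2; have h0 : 0 < h by rewrite divr_gt0// subr_gt0.
  have [C [d1 d10 hC]] := ub _ h0.
  apply/lee_addgt0Pr => x x0; rewrite add0e.
  (* Chosen so that [e < y] makes [e^h] times the constant at most [x]; the added [1] keeps the
     divisor positive. *)
  pose y := (x / (`|C| + 1)) `^ h^-1.
  have C1 : 0 < `|C| + 1 by rewrite ltr_wpDl.
  have xC0 : 0 < x / (`|C| + 1) by rewrite divr_gt0.
  have y0 : 0 < y by exact: powR_gt0.
  apply: (@upper_mink_le _ _ (Num.min d1 y)); first by rewrite lt_min d10.
  move=> e /andP[e0]; rewrite lt_min => /andP[ed1 ey].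
  apply: (le_trans (mink_ratio_le s _ _ _ _ e0 (hC _ _))); first by rewrite e0.
  rewrite lee_fin (_ : s - (d + h) = h); last by rewrite /h; field.
  have eh : e `^ h <= x / (`|C| + 1).
    apply: (@le_trans _ _ (y `^ h)); first by rewrite ge0_ler_powR ?nnegrE ?ltW.
    by rewrite /y -powRrM mulVf ?gt_eqF// powRr1 ?(ltW xC0).
  apply: (@le_trans _ _ ((`|C| + 1) * e `^ h)).
    by rewrite ler_wpM2r ?powR_ge0// (le_trans (ler_norm _))// lerDl.
  by rewrite mulrC -ler_pdivlMr.
have lo s : s < d -> (0 < lower_mink s B)%E.
  move=> sd; apply: (@lt_le_trans _ _ c%:E); first by rewrite lte_fin.
  apply: (@lower_mink_ge _ _ (Num.min d0 1)); first by rewrite lt_min d00 ltr01.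
  move=> e /andP[e0]; rewrite lt_min => /andP[ed0 e1].
  apply: le_trans (mink_ratio_ge s _ _ _ _ e0 (lb _ _)); last by rewrite e0.
  rewrite lee_fin ler_peMr ?(ltW c0)// -(powRr0 e).
  by rewrite ger_powR ?e0 ?(ltW e1)//; lra.
split; apply: ereal_inf_threshold => s sd /=.
- exact: up.
- move=> us; have := lower_mink_le_upper s B; rewrite us.
  by rewrite leNgt lo.
- apply/eqP; rewrite eq_le lower_mink_ge0 andbT -(up _ sd).
  exact: lower_mink_le_upper.
- by move=> ls; have := lo _ sd; rewrite ls ltxx.
Qed.

(** At the critical exponent the ratio is eventually within [h] of [M], so both contents equal [M].
    The instances [h = M / 2] and [h = 1] already determine the dimension. *)
Lemma minkowski_criterion (d M : R) B : 0 < M ->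
  (forall h, (0 < h)%R -> exists2 d0, (0 < d0)%R & forall e, (0 < e < d0)%R ->
     ((M - h) * e `^ (2 - d))%:E <= area (eps_nbhd B e) <=
       ((M + h) * e `^ (2 - d))%:E)%E ->
  upper_box_dim B = d%:E /\ lower_box_dim B = d%:E /\ minkowski_measurable B.
Proof.
move=> M0 hM.
have [ud ld] : upper_box_dim B = d%:E /\ lower_box_dim B = d%:E.
  apply: box_dim_criterion.
    have M2 : 0 < M / 2 by lra.
    have [d0 d00 h0] := hM _ M2.
    exists (M / 2) => //; exists d0 => // e ed; have /andP[+ _] := h0 _ ed.
    by rewrite (_ : M - M / 2 = M / 2)//; field.
  move=> h h0; have [d0 d00 hd] := hM _ ltr01.
  exists (M + 1), (Num.min d0 1); first by rewrite lt_min d00 ltr01.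
  move=> e /andP[e0]; rewrite lt_min => /andP[ed0 e1].
  have /andP[_] := hd e ltac:(by rewrite e0).
  move=> /le_trans; apply; rewrite lee_fin ler_wpM2l; [by []|lra|].
  by rewrite ger_powR ?e0 ?ltW//; lra.
split=> //; split=> //; exists d; split=> //; split=> //.
have uM : (upper_mink d B <= M%:E)%E.
  apply/lee_addgt0Pr => x x0; have [d0 d00 h0] := hM _ x0.
  apply: (upper_mink_le _ _ _ _ d00) => e ed; have /andP[_ h] := h0 _ ed.
  have /andP[e0 _] := ed.
  by apply: (le_trans (mink_ratio_le d _ _ _ _ e0 h)); rewrite subrr powRr0 mulr1.
have lM : (M%:E <= lower_mink d B)%E.
  apply/lee_subgt0Pr => x x0; have [d0 d00 h0] := hM _ x0.
  apply: (lower_mink_ge _ _ _ _ d00) => e ed; have /andP[h _] := h0 _ ed.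
  have /andP[e0 _] := ed.
  by apply: (le_trans _ (mink_ratio_ge d _ _ _ _ e0 h)); rewrite subrr powRr0 mulr1.
have lu := lower_mink_le_upper d B.
have -> : upper_mink d B = M%:E.
  by apply/eqP; rewrite eq_le uM (le_trans lM).
have -> : lower_mink d B = M%:E.
  by apply/eqP; rewrite eq_le lM (le_trans lu).
by rewrite ltry lte_fin.
Qed.

End minkowski_criteria.

(** * Neighbourhoods of Lipschitz curves *)

Section covering.
Context {R : realType}.
Local Notation T := (measurableTypeR R).
Implicit Types (B : set (R * R)) (p q z : R * R).

Lemma le_edist1 p q : `|p.1 - q.1| <= edist p q.
Proof. by rewrite -sqrtr_sqr ler_wsqrtr// lerDl sqr_ge0. Qed.

Lemma le_edist2 p q : `|p.2 - q.2| <= edist p q.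
Proof. by rewrite -sqrtr_sqr ler_wsqrtr// lerDr sqr_ge0. Qed.

Lemma edist_le p q : edist p q <= `|p.1 - q.1| + `|p.2 - q.2|.
Proof.
rewrite -[leRHS]ger0_norm ?addr_ge0// -sqrtr_sqr ler_wsqrtr// [leRHS]sqrrD.
by rewrite !real_normK ?num_real// lerD2r lerDl mulrn_wge0 // mulr_ge0.
Qed.

Lemma edist_ge0 p q : 0 <= edist p q. Proof. exact: sqrtr_ge0. Qed.

Lemma sqr_edist p q : edist p q ^+ 2 = (p.1 - q.1) ^+ 2 + (p.2 - q.2) ^+ 2.
Proof. by rewrite sqr_sqrtr// addr_ge0// sqr_ge0. Qed.

Lemma edist_triangle p q z : edist p z <= edist p q + edist q z.
Proof.
rewrite -(@ler_pXn2r _ 2)// ?nnegrE ?addr_ge0 ?edist_ge0// sqrrD !sqr_edist.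
set a := p.1 - q.1; set b := p.2 - q.2; set c := q.1 - z.1; set d := q.2 - z.2.
have -> : p.1 - z.1 = a + c by rewrite /a /c; ring.
have -> : p.2 - z.2 = b + d by rewrite /b /d; ring.
have h : a * c + b * d <= edist p q * edist q z.
  apply: (le_trans (ler_norm _)).
  rewrite -(@ler_pXn2r _ 2)// ?nnegrE ?mulr_ge0 ?edist_ge0//.
  rewrite real_normK ?num_real// exprMn !sqr_edist -/a -/b -/c -/d -subr_ge0.
  suff -> : (a ^+ 2 + b ^+ 2) * (c ^+ 2 + d ^+ 2) - (a * c + b * d) ^+ 2 =
    (a * d - b * c) ^+ 2 by exact: sqr_ge0.
  by ring.
rewrite -subr_ge0.
suff -> : a ^+ 2 + b ^+ 2 + edist p q * edist q z *+ 2 + (c ^+ 2 + d ^+ 2) -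
  ((a + c) ^+ 2 + (b + d) ^+ 2) = 2 * (edist p q * edist q z - (a * c + b * d)).
  by rewrite mulr_ge0// subr_ge0.
by ring.
Qed.

Lemma measurable_eps_nbhd B (e : R) :
  measurable (eps_nbhd B e : set (T * T)%type).
Proof.
apply: box_open_measurable => p [q Bq pq].
exists ((e - edist p q) / 2); first by rewrite divr_gt0// subr_gt0.
move=> z z1 z2; exists q => //; apply: le_lt_trans (edist_triangle z p q) _.
by have := edist_le z p; lra.
Qed.

Lemma area_le (A B : set (T * T)%type) :
  measurable A -> measurable B -> A `<=` B -> (area A <= area B)%E.
Proof. by move=> mA mB AB; apply: le_measure => //; rewrite inE. Qed.

Lemma area_setU (A B : set (T * T)%type) :
  measurable A -> measurable B -> (area (A `|` B) <= area A + area B)%E.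
Proof. by move=> mA mB; exact: measureU2. Qed.

Lemma area_cover (A : set (T * T)%type) (n : nat) (c : nat -> R * R) (h : R) :
  measurable A -> 0 <= h ->
  (forall p, A p -> exists2 i, (i < n)%N &
     `|p.1 - (c i).1| <= h /\ `|p.2 - (c i).2| <= h) ->
  (area A <= (n%:R * (4 * h ^+ 2))%:E)%E.
Proof.
move=> mA h0 Ac.
pose b i : set (T * T)%type := `[(c i).1 - h, (c i).1 + h]%classic `*`
  `[(c i).2 - h, (c i).2 + h]%classic.
have mb i : measurable (b i) by apply: measurableX; exact: measurable_itv.
apply: (le_trans (content_subadditive _ (F := b) (n := n) _ mA _)).
- by move=> i _; exact: mb.
- move=> p /Ac [i ni [p1 p2]]; rewrite -bigcup_mkord; exists i => //.
  by split; rewrite /= in_itv/= -ler_distl.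
have hh (x : R) : (lebesgue_measure (`[(x - h)%R, (x + h)%R]%classic : set R) = (2 * h)%:E)%E.
  rewrite lebesgue_measure_itv/= lte_fin; case: ltP => hx.
    by rewrite -EFinB; congr EFin; ring.
  by have -> : h = 0; [lra|rewrite mulr0].
have hb i : area (b i) = ((2 * h) * (2 * h))%:E.
  by rewrite /area /b product_measure1E// EFinM; congr (_ * _)%E; exact: hh.
rewrite (eq_bigr (fun=> ((2 * h) * (2 * h))%:E)) => [|i _]; last exact: hb.
rewrite sumEFin lee_fin sumr_const card_ord -[leLHS]mulr_natl.
by rewrite (_ : 2 * h * (2 * h) = 4 * h ^+ 2)//; ring.
Qed.

(** The parameter interval is cut into cells of length [e]. Over one cell each coordinate varies by
    at most [L * e], so a square of half-side [(L + 1) * e] around a sample point covers the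
    neighbourhood of that piece. As [S] is an arbitrary subset, the sample is taken inside [S], not
    at the end of the cell. *)
Lemma area_eps_nbhd_lipschitz (S : set R) (X Y : R -> R) (a b L e : R) :
  a <= b -> 0 <= L -> 0 < e -> (forall t, S t -> a <= t <= b) ->
  (forall s t, S s -> S t -> `|X s - X t| <= L * `|s - t|) ->
  (forall s t, S s -> S t -> `|Y s - Y t| <= L * `|s - t|) ->
  (area (eps_nbhd [set (X t, Y t) | t in S] e) <=
     (4 * (L + 1) ^+ 2 * (b - a + e) * e)%:E)%E.
Proof.
move=> ab L0 e0 Sab LX LY.
pose cell (i : nat) := [set t | S t /\ a + i%:R * e <= t <= a + i%:R * e + e].
(* The default [a] only fills cells without a point of [S]; no point of the neighbourhood is
   assigned to such a cell. *)
pose t_ i := xget a (cell i).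
pose n := (Num.truncn ((b - a) / e)).+1.
have ba0 : 0 <= (b - a) / e by rewrite divr_ge0 ?subr_ge0 ?(ltW e0).
have Le0 : 0 <= (L + 1) * e by apply: mulr_ge0; lra.
apply: (@le_trans _ _ (n%:R * (4 * ((L + 1) * e) ^+ 2))%:E).
  apply: (area_cover _ n (fun i => (X (t_ i), Y (t_ i)))).
- exact: measurable_eps_nbhd.
- exact: Le0.
- move=> p [_ [t St <-] pt].
  have /andP[ta tb] := Sab _ St.
  have ta0 : 0 <= (t - a) / e by rewrite divr_ge0 ?subr_ge0 ?(ltW e0).
  pose i := Num.truncn ((t - a) / e).
  have /andP[il ir] := truncn_itv ta0.
  have ci : cell i t.
    split=> //; rewrite -/i in il ir; move: il ir.
    rewrite ler_pdivlMr// ltr_pdivrMr// -natr1 mulrDl mul1r => il ir.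
    by apply/andP; split; lra.
  exists i.
    rewrite ltnS; apply: le_truncn.
    by rewrite ler_pM2r ?invr_gt0// lerB.
  have [Sti /andP[til tir]] : cell i (t_ i) by apply: (xgetI a ci).
  have tti : `|t - t_ i| <= e.
    by case: ci => _ /andP[? ?]; rewrite ler_norml; apply/andP; split; lra.
  have Lt : L * `|t - t_ i| <= L * e by rewrite ler_wpM2l.
  split=> /=.
    have := le_edist1 p (X t, Y t); have := LX _ _ St Sti; have := ler_distD (X t) p.1 (X (t_ i)).
    by rewrite /= => *; lra.
  have := le_edist2 p (X t, Y t); have := LY _ _ St Sti; have := ler_distD (Y t) p.2 (Y (t_ i)).
  by rewrite /= => *; lra.
rewrite lee_fin.
have ne : n%:R * e <= b - a + e.
  have /andP[+ _] := truncn_itv ba0.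
  by rewrite ler_pdivlMr// /n -natr1 [(_ + 1) * e]mulrDl mul1r lerD2r.
have -> : n%:R * (4 * ((L + 1) * e) ^+ 2) = (4 * (L + 1) ^+ 2 * e) * (n%:R * e) by ring.
have -> : 4 * (L + 1) ^+ 2 * (b - a + e) * e = (4 * (L + 1) ^+ 2 * e) * (b - a + e) by ring.
by rewrite ler_wpM2l// mulr_ge0 ?(ltW e0)// mulr_ge0// sqr_ge0.
Qed.

End covering.

(** * The power spiral *)

Section calculus.
Context {R : realType}.
Implicit Types (f df : R -> R) (a b x y s t phi psi : R).

Lemma mvt_is_derive f df a b : a <= b ->
  (forall x, a <= x <= b -> is_derive x 1 f (df x)) ->
  exists2 c, a <= c <= b & f b - f a = df c * (b - a).
Proof.
move=> ab fdf; have [||c cab ->] := @MVT_segment _ f df a b ab.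
- move=> x; rewrite in_itv/= => /andP[ax xb]; apply: fdf.
  by rewrite !ltW.
- apply: derivable_within_continuous => x; rewrite in_itv/= => axb.
  by have := fdf _ axb => ?; exact: ex_derive.
- by exists c => //; rewrite in_itv/= in cab.
Qed.

Lemma cosD2pin x (n : nat) : cos (x + n%:R * (2 * pi)) = cos x.
Proof.
elim: n => [|n ih]; first by rewrite mul0r addr0.
rewrite -natr1 mulrDl mul1r addrA -[RHS]ih mulr2n mulrDl mul1r addrA.
by rewrite !cosDpi opprK.
Qed.

Lemma sinD2pin x (n : nat) : sin (x + n%:R * (2 * pi)) = sin x.
Proof.
elim: n => [|n ih]; first by rewrite mul0r addr0.
rewrite -natr1 mulrDl mul1r addrA -[RHS]ih mulr2n mulrDl mul1r addrA.
by rewrite !sinDpi opprK.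
Qed.

Lemma angle_representative s phi psi :
  exists u, [/\ s < u, u <= s + 2 * pi, cos (u + psi) = cos phi &
    sin (u + psi) = sin phi].
Proof.
have pp : 0 < 2 * pi :> R by rewrite mulr_gt0// pi_gt0.
suff [u [su us cu su']] : exists u, [/\ s < u, u <= s + 2 * pi, cos u = cos (phi - psi) &
    sin u = sin (phi - psi)].
  exists u; split=> //.
    by rewrite cosD cu su' -cosD subrK.
  by rewrite sinD cu su' -sinD subrK.
set th := phi - psi.
(* Removing [m + 1] full turns brings the angle below [s]; turns are then added back until it enters
   the window of length [2 * pi]. *)
pose m := Num.truncn (`|s| / (2 * pi) + `|th| / (2 * pi)).
pose th' := th - m.+1%:R * (2 * pi).
have [c' s'] : cos th' = cos th /\ sin th' = sin th.
  by rewrite -(cosD2pin th' m.+1) -(sinD2pin th' m.+1) /th' subrK.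
have th's : th' <= s.
  have /andP[_] : m%:R <= `|s| / (2 * pi) + `|th| / (2 * pi) < m.+1%:R.
    by apply: truncn_itv; rewrite addr_ge0// divr_ge0// ltW.
  rewrite -mulrDl ltr_pdivrMr// /th' => h.
  have := ler_norm th; have := ler_norm (- s); rewrite normrN; lra.
have d0 : 0 <= (s - th') / (2 * pi) by rewrite divr_ge0 ?subr_ge0// ltW.
pose n := (Num.truncn ((s - th') / (2 * pi))).
have /andP[nl nr] := truncn_itv d0.
exists (th' + n.+1%:R * (2 * pi)); split.
- by move: nr; rewrite ltr_pdivrMr// /n; lra.
- move: nl; rewrite ler_pdivlMr// -/n => nl.
  by rewrite -natr1 [X in _ + X]mulrDl mul1r; lra.
- by rewrite cosD2pin.
- by rewrite sinD2pin.
Qed.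

Lemma cos_ge_half x : 0 <= x <= pi / 4 -> 1 / 2 <= cos x.
Proof.
move=> /andP[x0 x4]; have p0 := @pi_gt0 R.
have c0 : 0 <= cos x by apply: cos_ge0_pihalf; apply/andP; split; lra.
have c2 : 0 <= cos (x + x) by apply: cos_ge0_pihalf; apply/andP; split; lra.
have := cos2Dsin2 x; rewrite cosD in c2; nra.
Qed.

(** The bound [cos >= 1 / 2] on [[0, pi / 4]] serves twice: in the mean value theorem for
    [sin (x / 2)] and in [sin x = 2 sin (x / 2) cos (x / 2)]. *)
Lemma sin_ge_quarter x : 0 <= x <= pi / 2 -> x / 4 <= sin x.
Proof.
move=> /andP[x0 xp].
have p0 := @pi_gt0 R.
have z0 : 0 <= x / 2 by lra.
have [c /andP[c0 cx]] := @mvt_is_derive sin cos 0 (x / 2) z0 (fun y _ => is_derive_sin y).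
rewrite sin0 !subr0 => sc.
have h1 : 1 / 2 <= cos c by apply: cos_ge_half; apply/andP; split; lra.
have h2 : 1 / 2 <= cos (x / 2) by apply: cos_ge_half; apply/andP; split; lra.
rewrite (_ : sin x = sin (x / 2 + x / 2)); last by congr sin; field.
have s4 : x / 2 * (1 / 2) <= sin (x / 2) by rewrite sc mulrC ler_wpM2r.
have : x / 2 * (1 / 2) * (1 / 2) <= sin (x / 2) * cos (x / 2).
  by apply: ler_pM => //; lra.
by rewrite sinD; lra.
Qed.

(** Here [1 - cos x = 2 sin^2 (x / 2)], and [sin_ge_quarter] bounds the sine of |x|/2 below by
    |x|/8. *)
Lemma one_sub_cos_ge x : `|x| <= pi -> x ^+ 2 / 32 <= 1 - cos x.
Proof.
move=> xp.
have : `|x| / 2 / 4 <= sin (`|x| / 2).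
  by apply: sin_ge_quarter; apply/andP; split; [rewrite divr_ge0|lra].
have -> : cos x = cos (`|x| / 2 + `|x| / 2).
  rewrite (_ : `|x| / 2 + `|x| / 2 = `|x|); last by field.
  by case: (ler0P x) => // _; rewrite cosN.
have -> : x ^+ 2 = `|x| ^+ 2 by rewrite real_normK ?num_real.
rewrite cosD; have := cos2Dsin2 (`|x| / 2); have := normr_ge0 x.
set y := `|x|; nra.
Qed.

End calculus.

(** * The profile of the spiral, its slope and its primitive *)

Section power_profile.
Context {R : realType} (al b : R) (al0 : 0 < al) (al1 : al < 1) (b0 : 0 < b).
Implicit Types (s t u : R).

Definition profile s : R := b * s `^ (- al).
Definition profile_slope s : R := al * b * s `^ (- al - 1).
Definition profile_primitive s : R := b / (1 - al) * s `^ (1 - al).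

Local Notation f := profile.
Local Notation D := profile_slope.
Local Notation F := profile_primitive.

Lemma powRN_le (p s t : R) : 0 <= p -> 0 < s -> s <= t -> t `^ (- p) <= s `^ (- p).
Proof.
move=> p0 s0 st; have t0 : 0 < t by exact: lt_le_trans st.
rewrite !powRN lef_pV2 ?posrE ?powR_gt0//.
by apply: ge0_ler_powR; rewrite // nnegrE ltW.
Qed.

Lemma profile_gt0 s : 0 < s -> 0 < f s.
Proof. by move=> s0; rewrite mulr_gt0// powR_gt0. Qed.

Lemma profile_slope_gt0 s : 0 < s -> 0 < D s.
Proof. by move=> s0; rewrite !mulr_gt0// powR_gt0. Qed.

Lemma profile_le s t : 0 < s -> s <= t -> f t <= f s.
Proof. by move=> s0 st; rewrite ler_pM2l// powRN_le// ltW. Qed.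

Lemma profile_slope_le s t : 0 < s -> s <= t -> D t <= D s.
Proof.
move=> s0 st; rewrite ler_pM2l ?mulr_gt0//.
by rewrite (_ : - al - 1 = - (al + 1)) ?powRN_le//; [have := al0; lra|ring].
Qed.

Lemma profile_slope_lt s t : 0 < s -> s < t -> D t < D s.
Proof.
move=> s0 st; rewrite ltr_pM2l ?mulr_gt0//.
have t0 : 0 < t by exact: lt_trans st.
rewrite (_ : - al - 1 = - (al + 1)); last by ring.
rewrite !powRN ltf_pV2 ?posrE ?powR_gt0//.
by apply: gt0_ltr_powR; rewrite ?nnegrE ?(ltW s0) ?(ltW t0)//; have := al0; lra.
Qed.

Lemma profile_slopeE s : 0 < s -> D s = al * f s / s.
Proof.
move=> s0; rewrite /D /f gt0_powRD// powR_inv1; last exact: ltW.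
by ring.
Qed.

Lemma is_derive_profile s : 0 < s -> is_derive s 1 f (- D s).
Proof.
move=> s0.
have h := is_derive1_powR (- al) s0.
have := is_deriveZ b h.
by rewrite (_ : b *: _ = - D s) // /D /GRing.scale/=; ring.
Qed.

Lemma is_derive_primitive s : 0 < s -> is_derive s 1 F (f s).
Proof.
move=> s0.
have h := is_derive1_powR (1 - al) s0.
have := is_deriveZ (b / (1 - al)) h.
rewrite (_ : _ *: _ = f s) // /f /GRing.scale/= (_ : 1 - al - 1 = - al); last by ring.
by field; rewrite subr_eq0 gt_eqF.
Qed.

Lemma profile_sub s t : 0 < s -> s <= t ->
  D t * (t - s) <= f s - f t <= D s * (t - s).
Proof.
move=> s0 st.
have [|c /andP[sc ct] fc] := @mvt_is_derive _ f (fun x => - D x) s t st.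
  by move=> x /andP[sx _]; apply: is_derive_profile; exact: lt_le_trans sx.
have -> : f s - f t = D c * (t - s) by rewrite -opprB fc mulNr opprK.
have ts : 0 <= t - s by rewrite subr_ge0.
apply/andP; split; apply: ler_wpM2r => //; apply: profile_slope_le => //.
exact: lt_le_trans sc.
Qed.

Lemma primitive_sub s t : 0 < s -> s <= t ->
  f t * (t - s) <= F t - F s <= f s * (t - s).
Proof.
move=> s0 st.
have [|c /andP[sc ct] ->] := @mvt_is_derive _ F f s t st.
  by move=> x /andP[sx _]; apply: is_derive_primitive; exact: lt_le_trans sx.
have ts : 0 <= t - s by rewrite subr_ge0.
apply/andP; split; apply: ler_wpM2r => //; apply: profile_le => //.
exact: lt_le_trans sc.
Qed.

Lemma primitive_le s t : 0 < s -> s <= t -> F s <= F t.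
Proof.
move=> s0 st; have /andP[h _] := primitive_sub s t s0 st.
rewrite -subr_ge0; apply: le_trans h; rewrite mulr_ge0 ?subr_ge0//.
by rewrite ltW// profile_gt0//; exact: lt_le_trans st.
Qed.

Lemma primitive_gt0 s : 0 < s -> 0 < F s.
Proof. by move=> s0; rewrite mulr_gt0 ?powR_gt0// divr_gt0// subr_gt0. Qed.

(** The factor is [al * 2^al * 2 <= 4]. The slope at [s / 2] dominates the slope at every parameter
    within one turn of [s] as soon as [s >= 4 * pi]. *)
Lemma profile_half s : 0 < s -> D (s / 2) <= 4 * f s / s.
Proof.
move=> s0; have s20 : 0 < s / 2 by rewrite divr_gt0.
rewrite profile_slopeE// invf_div.
have -> : f (s / 2) = 2 `^ al * f s.
  rewrite /f powRM ?(ltW s0) ?invr_ge0//.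
  rewrite -(powR_inv1 (ltW (ltr0n R 2)))// -powRrM mulN1r opprK; ring.
have p2 : 2 `^ al <= 2 :> R.
  by rewrite -[leRHS](powRr1 (ltW (ltr0n R 2))) ler_powR ?ler1n ?(ltW al1).
have fs := profile_gt0 s s0.
have -> : al * (2 `^ al * f s) * (2 / s) = (al * 2 `^ al) * (2 * f s / s) by ring.
have -> : 4 * f s / s = 2 * (2 * f s / s) by ring.
apply: ler_wpM2r.
  by apply: divr_ge0; [apply: mulr_ge0 => //; exact: ltW|exact: ltW].
apply: (@le_trans _ _ (1 * 2)); last by rewrite mul1r.
by apply: ler_pM; rewrite ?powR_ge0 ?(ltW al0) ?(ltW al1).
Qed.

Lemma profile_small (r : R) : 0 < r -> exists2 s, 0 < s & f s < r.
Proof.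
move=> r0; have h0 : 0 < r / (2 * b) by rewrite divr_gt0// mulr_gt0.
exists ((r / (2 * b)) `^ (- al^-1)); first exact: powR_gt0.
rewrite /f -powRrM mulrNN mulVf ?gt_eqF// powRr1 ?(ltW h0)//.
rewrite (_ : b * (r / (2 * b)) = r / 2); last by field; rewrite gt_eqF.
lra.
Qed.

(** * Ray masses of the neighbourhood of the spiral *)

Definition spiral (psi : R) (J : set R) : set (R * R) :=
  [set (f s * cos (s + psi), f s * sin (s + psi)) | s in J].

Lemma edist_ray (r phi f0 : R) :
  edist (r * cos phi, r * sin phi) (f0 * cos phi, f0 * sin phi) = `|r - f0|.
Proof.
rewrite /edist/= -sqrtr_sqr; congr Num.sqrt.
rewrite -!mulrBl !exprMn -mulrDr [X in _ * X](_ : _ = 1) ?mulr1//.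
exact: cos2Dsin2.
Qed.

(** The shifts by [2 * pi] pay for rounding to crossings of the ray: [u n <= sigma < u n.+1], and
    the first crossing is at most [s0 + 2 * pi]. Since [f] decreases, [2 * pi * f (u i)] is at least
    the integral of [f] over the following turn, so the masses [2 * e * f (u i)] are bounded below
    by a telescoping sum. *)
Lemma ray_mass_spiral_ge (J : set R) (s0 psi e sigma phi : R) :
  0 < s0 -> (forall s, s0 < s -> J s) -> 0 < e -> pi * D sigma = e ->
  s0 + 4 * pi <= sigma ->
  ((f (sigma + 2 * pi) ^+ 2 / 2 +
     e / pi * (F (sigma - 2 * pi) - F (s0 + 2 * pi)))%:E <=
   ray_mass (eps_nbhd (spiral psi J) e) phi)%E.
Proof.
move=> s00 Js e0 De s0sigma; have pp := @pi_gt0 R.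
have [u0 [u0l u0r cu su]] := angle_representative s0 phi psi.
(* The parameters at which the curve crosses the ray of angle [phi]. *)
pose u (j : nat) := u0 + j%:R * (2 * pi).
have uS j : u j.+1 = u j + 2 * pi by rewrite /u -natr1; ring.
have u_ge j : u0 <= u j by rewrite lerDl mulr_ge0// mulr_ge0// ltW.
have u_gt0 j : 0 < u j by have := u_ge j; lra.
have u_le i j : (i <= j)%N -> u i <= u j.
  by move=> ij; rewrite lerD2l ler_wpM2r ?ler_nat// mulr_ge0// ltW.
have near_spiral j r : `|r - f (u j)| < e ->
    eps_nbhd (spiral psi J) e (r * cos phi, r * sin phi).
  move=> rf; exists (f (u j) * cos (u j + psi), f (u j) * sin (u j + psi)).
    by exists (u j) => //; apply: Js; have := u_ge j; lra.
  have -> : cos (u j + psi) = cos phi by rewrite /u addrAC cosD2pin cu.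
  have -> : sin (u j + psi) = sin phi by rewrite /u addrAC sinD2pin su.
  by rewrite edist_ray.
have x0 : 0 <= (sigma - u0) / (2 * pi).
  by apply: divr_ge0; lra.
pose n := Num.truncn ((sigma - u0) / (2 * pi)).
have [un unS] : u n <= sigma /\ sigma < u n.+1.
  have /andP[] := truncn_itv x0; rewrite -/n ler_pdivlMr ?ltr_pdivrMr; [|lra..].
  by rewrite /u => ? ?; split; lra.
have gap_ge i : (i < n)%N -> 2 * e <= f (u i) - f (u i.+1).
  move=> ni; have /andP[+ _] := profile_sub _ _ (u_gt0 i) (u_le _ _ (leqnSn i)).
  apply: le_trans.
  have : D sigma <= D (u i.+1).
    by apply: profile_slope_le => //; apply: le_trans un; exact: u_le.
  rewrite uS -De => h; have -> : u i + 2 * pi - u i = 2 * pi by ring.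
  have -> : 2 * (pi * D sigma) = D sigma * (2 * pi) by ring.
  by rewrite ler_wpM2r// mulr_ge0// ltW.
have gap_lt i : (n < i)%N -> f (u i) - f (u i.+1) < 2 * e.
  move=> ni; have /andP[_] := profile_sub _ _ (u_gt0 i) (u_le _ _ (leqnSn i)).
  move=> /le_lt_trans; apply.
  have : D (u i) < D sigma.
    by apply: profile_slope_lt; [lra|apply: lt_le_trans unS _; exact: u_le].
  rewrite uS -De => h; have -> : u i + 2 * pi - u i = 2 * pi by ring.
  have -> : 2 * (pi * D sigma) = D sigma * (2 * pi) by ring.
  by rewrite ltr_pM2r// mulr_gt0.
have fu_le i j : (i <= j)%N -> f (u j) <= f (u i).
  by move=> ij; apply: profile_le => //; exact: u_le.
have fu_gt0 i : 0 < f (u i) by exact: profile_gt0.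
apply: le_trans (ray_mass_ge _ phi (f (u n.+1)) n
  (fun i => f (u i) - e) (fun i => f (u i) + e) _ _ _ _ _ _); last 6 first.
- exact: measurable_eps_nbhd.
- exact/ltW/fu_gt0.
- move=> i ni; have := gap_ge _ ni; have := fu_le i.+1 n.+1 (leq_trans ni (leqnSn n)).
  by move=> *; apply/andP; split; lra.
- move=> i j /andP[ij jn]; have := gap_ge _ (ltn_trans ij jn).
  by have := fu_le _ _ ij; lra.
- move=> r /andP[r0 rc].
  (* Minimality of [j] places [r] between two consecutive crossings. They lie beyond [sigma], hence
     less than [2 * e] apart, and one of them is within [e] of [r]. *)
  have exj : exists j, f (u (n.+1 + j).+1%N) < r.
    have [s s_gt0 fsr] := profile_small _ r0.
    exists (Num.truncn (s / (2 * pi))); apply: le_lt_trans fsr.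
    apply: profile_le => //.
    have : 0 <= s / (2 * pi) by apply: divr_ge0; lra.
    move=> /truncn_itv/andP[_]; rewrite ltr_pdivrMr; last lra.
    move=> /ltW/le_trans; apply.
    apply: (@le_trans _ _ ((n.+1 + Num.truncn (s / (2 * pi))).+1%N%:R * (2 * pi))).
      by rewrite ler_wpM2r ?ler_nat ?ltnS ?leq_addl//; lra.
    by rewrite /u; lra.
  case: (ex_minnP exj) => j jr jmin.
  have rj : r <= f (u (n.+1 + j)%N).
    case: j jmin {jr} => [|j] jmin; first by rewrite addn0 ltW.
    by rewrite leNgt addnS; apply/negP => /jmin; rewrite ltnn.
  have gj := gap_lt (n.+1 + j)%N (leq_addr _ _).
  have [h|h] := ltP (f (u (n.+1 + j)%N) - r) e.
    by apply: (near_spiral (n.+1 + j)%N); rewrite ltr_norml; apply/andP; split; lra.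
  by apply: (near_spiral (n.+1 + j).+1%N); rewrite ltr_norml; apply/andP; split; lra.
- move=> r i ni /andP[lr rr]; apply: (near_spiral i).
  by rewrite ltr_norml; apply/andP; split; lra.
rewrite lee_fin; apply: lerD.
  rewrite ler_pM2r ?invr_gt0// ler_pXn2r ?nnegrE ?(ltW (fu_gt0 _))//.
    by apply: profile_le => //; rewrite uS; lra.
  by apply/ltW/profile_gt0; lra.
have step i : e / pi * (F (u i.+1) - F (u i)) <= ((f (u i) + e) ^+ 2 - (f (u i) - e) ^+ 2) / 2.
  have /andP[_] := primitive_sub _ _ (u_gt0 i) (u_le _ _ (leqnSn i)).
  rewrite uS; have -> : u i + 2 * pi - u i = 2 * pi by ring.
  move=> h; have -> : ((f (u i) + e) ^+ 2 - (f (u i) - e) ^+ 2) / 2 =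
    e / pi * (f (u i) * (2 * pi)).
    have key (q p x : R) : ((x + q * p) ^+ 2 - (x - q * p) ^+ 2) / 2 = q * (x * (2 * p)).
      by field.
    by rewrite -key divfK// lt0r_neq0.
  by rewrite ler_wpM2l// divr_ge0// ltW.
apply: (@le_trans _ _ (\sum_(i < n) e / pi * (F (u i.+1) - F (u i)))); last exact: ler_sum.
rewrite -mulr_sumr; apply: ler_wpM2l; first by rewrite divr_ge0// ltW.
have -> : \sum_(i < n) (F (u i.+1) - F (u i)) = F (u n) - F (u 0%N).
  by rewrite -(big_mkord xpredT (fun i => F (u i.+1) - F (u i))) telescope_sumr.
apply: lerB.
  by apply: primitive_le; [lra|rewrite uS in unS; lra].
by apply: primitive_le => //; rewrite /u mul0r addr0.
Qed.

Lemma edist_polar (r r' phi phi' : R) :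
  edist (r * cos phi, r * sin phi) (r' * cos phi', r' * sin phi') ^+ 2 =
  (r - r') ^+ 2 + 2 * (r * r') * (1 - cos (phi' - phi)).
Proof.
rewrite sqr_edist/= cosB.
have h := cos2Dsin2 phi; have h' := cos2Dsin2 phi'.
transitivity (r ^+ 2 * (cos phi ^+ 2 + sin phi ^+ 2) +
  r' ^+ 2 * (cos phi' ^+ 2 + sin phi' ^+ 2) -
  2 * (r * r') * (cos phi' * cos phi + sin phi' * sin phi)); first by ring.
by rewrite h h'; ring.
Qed.

(* A point of the ray at angle phi close to the turn at parameter s lies within
   24 e / S of the radius at which the curve itself crosses the ray nearby. *)
Lemma profile_crossing (S e r s u phi psi : R) :
  4 * pi <= S -> 0 < e -> S <= s -> 2 * e <= f s -> `|u - s| <= pi ->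
  cos (u + psi) = cos phi -> sin (u + psi) = sin phi ->
  edist (r * cos phi, r * sin phi) (f s * cos (s + psi), f s * sin (s + psi)) < e ->
  `|r - f s| < e -> `|r - f u| < e * (1 + 24 / S).
Proof.
move=> S4 e0 Ss efs us cu su pq rfs; have pp := @pi_gt0 R.
have s0 : 0 < s by lra.
have S0 : 0 < S by lra.
have u0 : 0 < u by move: us; rewrite ler_norml => /andP[? ?]; lra.
(* The law of cosines gives [2 * r * f s * (1 - cos (u - s)) < e^2]. With [r >= f s / 2] and
   [one_sub_cos_ge] this reads [(f s * (u - s))^2 < 32 * e^2], and [32 <= 6^2]. *)
have tau : f s * `|u - s| <= 6 * e.
  have pq2 : edist (r * cos phi, r * sin phi)
      (f s * cos (s + psi), f s * sin (s + psi)) ^+ 2 < e ^+ 2.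
    by rewrite ltr_pXn2r// nnegrE; [exact: edist_ge0|exact: ltW].
  rewrite edist_polar in pq2.
  have c : cos (s + psi - phi) = cos (u - s).
    rewrite cosB -cu -su -cosB (_ : s + psi - (u + psi) = - (u - s)) ?cosN//.
    by ring.
  rewrite c in pq2; have hc := one_sub_cos_ge _ us.
  have r2 : f s / 2 <= r by move: rfs; rewrite ltr_norml => /andP[? ?]; lra.
  have fs0 : 0 < f s by exact: profile_gt0.
  have h1 : f s ^+ 2 * ((u - s) ^+ 2 / 32) <= 2 * (r * f s) * (1 - cos (u - s)).
    apply: ler_pM => //; first by rewrite sqr_ge0.
      by rewrite divr_ge0 ?sqr_ge0.
    rewrite expr2 mulrA ler_pM2r//; lra.
  have h2 : (f s * `|u - s|) ^+ 2 <= (6 * e) ^+ 2.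
    rewrite exprMn real_normK ?num_real//.
    have := sqr_ge0 (r - f s); have := sqr_ge0 e; lra.
  rewrite -(@ler_pXn2r _ 2)// nnegrE; last by rewrite mulr_ge0// ltW.
  by rewrite mulr_ge0// ltW.
(* As [s >= 4 * pi], the parameter [u >= s - pi] stays above [s / 2], so this slope is valid all the
   way from [s] to [u]. *)
have slope x y : s / 2 <= x -> x <= y -> f x - f y <= D (s / 2) * (y - x).
  move=> sx xy; have x0 : 0 < x by lra.
  have /andP[_ h] := profile_sub _ _ x0 xy; apply: le_trans h _.
  by apply: ler_wpM2r; [rewrite subr_ge0|apply: profile_slope_le => //; lra].
have hfu : `|f s - f u| <= D (s / 2) * `|u - s|.
  move: (us); rewrite ler_norml => /andP[us1 us2].
  have [su'|us'] := leP s u.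
    rewrite ger0_norm ?subr_ge0 ?profile_le// ger0_norm ?subr_ge0//.
    by apply: slope => //; lra.
  rewrite distrC ger0_norm ?subr_ge0 ?profile_le ?(ltW us')//.
  rewrite distrC ger0_norm ?subr_ge0 ?(ltW us')//.
  by apply: slope => //; lra.
(* The constant [24] is the [6] of [tau] times the [4] of [profile_half]. *)
have h24 : `|f s - f u| <= e * (24 / S).
  apply: (le_trans hfu); have := profile_half s s0.
  move=> /ler_wpM2r => /(_ `|u - s| (normr_ge0 _)) /le_trans; apply.
  have -> : 4 * f s / s * `|u - s| = (f s * `|u - s|) * (4 / s) by ring.
  have -> : e * (24 / S) = (6 * e) * (4 / S) by ring.
  apply: ler_pM => //.
  - by rewrite mulr_ge0// ltW// profile_gt0.
  - by rewrite divr_ge0// ltW.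
  - by rewrite ler_pM2l// lef_pV2 ?posrE.
by have := ler_distD (f s) r (f u); lra.
Qed.

(** A point near a turn beyond [sigma] has radius below [f sigma + e]; near an earlier turn it falls
    into the enlarged interval of [profile_crossing], which requires [2 * e <= f sigma]. The
    crossings used have parameters up to [sigma + pi], so the last hypothesis keeps the left ends of
    these intervals nonnegative. *)
Lemma ray_mass_spiral_le (J : set R) (psi e sigma S phi : R) :
  4 * pi <= S -> S <= sigma -> (forall s, J s -> S <= s) -> 0 < e ->
  2 * e <= f sigma -> e * (1 + 24 / S) <= f (sigma + pi) ->
  (ray_mass (eps_nbhd (spiral psi J) e) phi <=
    ((f sigma + e) ^+ 2 / 2 + e * (1 + 24 / S) / pi * F (sigma + pi))%:E)%E.
Proof.
move=> S4 Ssigma JS e0 efs efsp; have pp := @pi_gt0 R.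
set e' := e * (1 + 24 / S) in efsp *.
have S0 : 0 < S by lra.
have e'0 : 0 < e' by rewrite mulr_gt0// addr_gt0// divr_gt0.
(* Starting the crossings in []S - pi, S + pi]] gives every [s >= S] a crossing in []s - pi, s +
   pi]]; [idx s] is its number. *)
have [u0 [u0l u0r cu su]] := angle_representative (S - pi) phi psi.
pose u (j : nat) := u0 + j%:R * (2 * pi).
have uS j : u j.+1 = u j + 2 * pi by rewrite /u -natr1; ring.
have u_ge j : u0 <= u j by rewrite lerDl mulr_ge0// mulr_ge0// ltW.
have u_gt0 j : 0 < u j by have := u_ge j; lra.
have u_le i j : (i <= j)%N -> u i <= u j.
  by move=> ij; rewrite lerD2l ler_wpM2r ?ler_nat// mulr_ge0// ltW.
pose idx s := Num.truncn ((s + pi - u0) / (2 * pi)).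
have idxP s : S <= s -> u (idx s) <= s + pi /\ s + pi < u (idx s).+1.
  move=> Ss; have x0 : 0 <= (s + pi - u0) / (2 * pi) by apply: divr_ge0; lra.
  have /andP[] := truncn_itv x0; rewrite -/(idx s) ler_pdivlMr ?ltr_pdivrMr; [|lra..].
  by rewrite /u => ? ?; split; lra.
pose n := (idx sigma).+1.
have un i : (i < n)%N -> u i <= sigma + pi.
  rewrite ltnS => /u_le/le_trans; apply.
  by have [] := idxP sigma Ssigma.
apply: le_trans (ray_mass_le _ phi (f sigma + e) n
  (fun i => f (u i) - e') (fun i => f (u i) + e') _ _ _ _) _.
- exact: measurable_eps_nbhd.
- have s_gt0 : 0 < sigma by lra.
  by have := profile_gt0 sigma s_gt0; lra.
- move=> i ni; have := profile_le _ _ (u_gt0 i) (un _ ni).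
  by move=> h; apply/andP; split; lra.
- move=> r r0 [_ [s sJ <-] pq]; have Ss := JS _ sJ.
  have s_gt0 : 0 < s by lra.
  have rfs : `|r - f s| < e.
    apply: le_lt_trans pq.
    rewrite -(@ler_pXn2r _ 2)// ?nnegrE ?edist_ge0// edist_polar.
    rewrite real_normK ?num_real// lerDl; apply: mulr_ge0.
      by have := mulr_gt0 r0 (profile_gt0 s s_gt0); lra.
    by rewrite subr_ge0 cos_le1.
  have [ssig|sigs] := leP sigma s.
    left; have h : f s <= f sigma by apply: profile_le => //; lra.
    by move: rfs; rewrite ltr_norml => /andP[_ ?]; lra.
  right; have [ul ur] := idxP _ Ss; exists (idx s).
    rewrite ltnS; apply: le_truncn.
    by rewrite ler_pM2r ?invr_gt0; lra.
  have hfs : 2 * e <= f s by apply: le_trans efs _; apply: profile_le => //; exact: ltW.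
  have : `|r - f (u (idx s))| < e'.
    apply: (@profile_crossing S e r s (u (idx s)) phi psi) => //.
    - by rewrite ler_norml; rewrite uS in ur; apply/andP; split; lra.
    - by rewrite /u addrAC cosD2pin cu.
    - by rewrite /u addrAC sinD2pin su.
  by rewrite ltr_norml => /andP[? ?]; apply/andP; split; lra.
rewrite lee_fin lerD2l.
(* For an upper bound [f (u i)] is compared with the integral of [f] over the preceding turn, which
   starts at [v i]; this is positive because [u0 > S - pi >= 3 * pi]. *)
pose v i := u i - 2 * pi.
have v_gt0 i : 0 < v i by have := u_ge i; rewrite /v; lra.
have step i : ((f (u i) + e') ^+ 2 - (f (u i) - e') ^+ 2) / 2 <= e' / pi * (F (v i.+1) - F (v i)).
  have vS : v i.+1 = u i by rewrite /v uS addrK.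
  have vu : v i <= u i by rewrite /v; lra.
  have /andP[+ _] := primitive_sub _ _ (v_gt0 i) vu.
  rewrite vS; have -> : u i - v i = 2 * pi by rewrite /v; ring.
  move=> h; have -> : ((f (u i) + e') ^+ 2 - (f (u i) - e') ^+ 2) / 2 =
    e' / pi * (f (u i) * (2 * pi)).
    have key (q p x : R) : ((x + q * p) ^+ 2 - (x - q * p) ^+ 2) / 2 = q * (x * (2 * p)).
      by field.
    by rewrite -key divfK// lt0r_neq0.
  by rewrite ler_wpM2l// divr_ge0// ltW.
apply: (@le_trans _ _ (\sum_(i < n) e' / pi * (F (v i.+1) - F (v i)))); first exact: ler_sum.
rewrite -mulr_sumr; apply: ler_wpM2l; first by rewrite divr_ge0// ltW.
have -> : \sum_(i < n) (F (v i.+1) - F (v i)) = F (v n) - F (v 0%N).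
  by rewrite -(big_mkord xpredT (fun i => F (v i.+1) - F (v i))) telescope_sumr.
have := primitive_gt0 _ (v_gt0 0%N).
have : F (v n) <= F (sigma + pi).
  by apply: primitive_le => //; rewrite /v uS addrK; exact: un.
lra.
Qed.

(** * Area of the neighbourhood of the spiral *)

Lemma spiral_lipschitz (trig : R -> R) (psi s0 s t : R) :
  (forall x : R, is_derive x 1 trig (trig (x + pi / 2))) -> (forall x : R, `|trig x| <= 1) ->
  0 < s0 -> s0 <= s -> s0 <= t ->
  `|f s * trig (s + psi) - f t * trig (t + psi)| <= (D s0 + f s0) * `|s - t|.
Proof.
move=> dtrig btrig s00.
wlog st : s t / s <= t.
  move=> h s0s s0t; have [st|/ltW ts] := leP s t; first exact: h.
  by rewrite distrC (distrC s); exact: h.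
move=> s0s s0t.
(* A quarter-turn shift expresses the derivative of [cos] and of [sin] in the same way, so one
   argument serves both coordinates. *)
pose df x := f x * trig (x + psi + pi / 2) - D x * trig (x + psi).
have [|c /andP[sc ct] h] := @mvt_is_derive _ (fun x => f x * trig (x + psi)) df s t st.
  move=> x /andP[sx _]; have x0 : 0 < x by lra.
  have h1 := is_derive_profile x x0.
  have h2 : is_derive x 1 (fun y => trig (y + psi)) (trig (x + psi + pi / 2)).
    have h3 : is_derive x 1 (fun y : R => y + psi) 1.
      by have := @is_deriveD _ R^o R^o id (cst psi) x 1 1 0 (is_derive_id _ _) (is_derive_cst _ _ _); rewrite addr0.
    by have := @is_derive1_comp _ trig (fun y => y + psi) x _ _ (dtrig (x + psi)) h3; rewrite mulr1.
  have := is_deriveM h1 h2; rewrite /GRing.scale/= /df.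
  by rewrite (_ : f x * _ + _ = f x * trig (x + psi + pi / 2) - D x * trig (x + psi))//; ring.
rewrite distrC h normrM (distrC s t); apply: ler_wpM2r => //.
have c0 : 0 < c by lra.
have fc := profile_gt0 c c0; have Dc := profile_slope_gt0 c c0.
apply: (le_trans (ler_normB _ _)); rewrite (normrM (f c)) (normrM (D c)) (gtr0_norm fc) (gtr0_norm Dc).
rewrite addrC; apply: lerD.
  rewrite -[leRHS]mulr1; apply: ler_pM => //; first exact: ltW.
  by apply: profile_slope_le => //; lra.
rewrite -[leRHS]mulr1; apply: ler_pM => //; first exact: ltW.
by apply: profile_le => //; lra.
Qed.

Lemma area_spiral_head (J : set R) (psi s0 S : R) : 0 < s0 -> s0 <= S ->
  (forall s, J s -> s0 <= s <= S) ->
  exists2 C, 0 <= C & forall e, 0 < e <= 1 ->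
    (area (eps_nbhd (spiral psi J) e) <= (C * e)%:E)%E.
Proof.
move=> s00 s0S Js.
have L0 : 0 <= D s0 + f s0 by rewrite addr_ge0// ltW ?profile_slope_gt0 ?profile_gt0.
exists (4 * (D s0 + f s0 + 1) ^+ 2 * (S - s0 + 1)).
  by rewrite mulr_ge0 ?mulr_ge0 ?sqr_ge0//; lra.
move=> e /andP[e0 e1].
apply: (le_trans (area_eps_nbhd_lipschitz J (fun s => f s * cos (s + psi))
  (fun s => f s * sin (s + psi)) s0 S (D s0 + f s0) e _ _ _ _ _ _)) => //.
- move=> s t /Js/andP[s0s _] /Js/andP[s0t _].
  apply: spiral_lipschitz => // x; last by rewrite ler_norml cos_geN1 cos_le1.
  by rewrite cosDpihalf; exact: is_derive_cos.
- move=> s t /Js/andP[s0s _] /Js/andP[s0t _].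
  apply: spiral_lipschitz => // x; last by rewrite ler_norml sin_geN1 sin_le1.
  by rewrite sinDpihalf; exact: is_derive_sin.
- rewrite lee_fin ler_pM2r// ler_wpM2l//; last lra.
  by rewrite mulr_ge0 ?sqr_ge0.
Qed.

(** With [e = pi * D s] the term [(e / pi) * F s] equals [al * f s ^+ 2 / (1 - al)], so [2 * pi]
    times the leading ray mass [f s ^+ 2 / 2 + (e / pi) * F s] is [A0 * f s ^+ 2]. *)
Local Notation A0 := (pi * (1 + al) / (1 - al)).

Lemma primitiveE s : 0 < s -> F s = f s * s / (1 - al).
Proof.
move=> s0; rewrite /F /f (_ : 1 - al = - al + 1); last by ring.
rewrite [in LHS]gt0_powRD// powRr1; last exact: ltW.
by ring.
Qed.

(** Writing the radius as [pi * D s] makes everything a function of [s]. The error [s^-1] is the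
    relative change of [f] over a bounded number of turns; [(f s * s)^-1] is the weight of a bounded
    term such as [F (s0 + 2 * pi)] against [F s], which is of order [f s * s]. *)
Lemma area_spiral_ge (J : set R) (s0 psi : R) :
  0 < s0 -> (forall s, s0 < s -> J s) ->
  exists2 C, 0 <= C & exists s1, forall s, s1 <= s ->
    (((A0 - C * (s^-1 + (f s * s)^-1)) * f s ^+ 2)%:E <=
      area (eps_nbhd (spiral psi J) (pi * D s)))%E.
Proof.
move=> s00 Js; have pp := @pi_gt0 R; have al_gt0 := al0; have al_lt1 := al1.
pose C0 := F (s0 + 2 * pi).
have C00 : 0 < C0 by apply: primitive_gt0; lra.
(* The summands pay for shifting [f] by a turn ([f2]), for shifting [F] by a turn ([F1]), and for
   the start of the primitive. *)
pose C := 2 * pi * (2 * pi + 4 * pi + C0).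
have C_ge0 : 0 <= C by rewrite mulr_ge0; lra.
exists C => //; exists (s0 + 8 * pi) => s s1s.
have s_gt0 : 0 < s by lra.
set g := f s; have g0 : 0 < g by exact: profile_gt0.
set e := pi * D s; have e0 : 0 < e by rewrite mulr_gt0// profile_slope_gt0.
pose y := s^-1; pose x := (g * s)^-1.
have y0 : 0 < y by rewrite invr_gt0.
have x0 : 0 < x by rewrite invr_gt0 mulr_gt0.
have ysE : y * s = 1 by rewrite mulVf// gt_eqF.
have gx : g * x = y by rewrite /x invfM mulrA divff ?mul1r// gt_eqF.
have y8 : y * (8 * pi) <= 1.
  by rewrite -[leRHS]ysE ler_pM2l//; lra.
have Ds : D s = al * g * y by rewrite profile_slopeE.
have eE : e / pi = al * g * y by rewrite /e mulrC mulKf ?Ds// gt_eqF.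
(* A negative lower bound holds trivially; [area_ge_ray_mass] takes a nonnegative one. *)
have [neg|pos] := ltP ((A0 - C * (y + x)) * g ^+ 2) 0.
  by apply: le_trans (area_ge0 _); rewrite lee_fin ltW.
pose bnd := (A0 - C * (y + x)) * g ^+ 2 / (2 * pi).
have -> : (A0 - C * (y + x)) * g ^+ 2 = 2 * pi * bnd.
  by rewrite /bnd [RHS]mulrC divfK// mulf_neq0// gt_eqF.
apply: area_ge_ray_mass.
- exact: measurable_eps_nbhd.
- by rewrite divr_ge0//; lra.
move=> phi; apply: le_trans (ray_mass_spiral_ge J s0 psi e s phi _ _ _ _ _) => //; last lra.
rewrite lee_fin eE -/C0.
have shrink z : 0 <= z -> al * z <= z by move=> z0; rewrite ler_piMl// ltW.
have f1 : g * (1 - 2 * pi * y) <= f (s + 2 * pi).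
  have /andP[_] := profile_sub s (s + 2 * pi) s_gt0 ltac:(lra).
  rewrite Ds -/g (_ : s + 2 * pi - s = 2 * pi); last by ring.
  by have := shrink _ (mulr_ge0 (ltW (mulr_gt0 g0 y0)) (ltW pp)); lra.
have f2 : g ^+ 2 * (1 - 4 * pi * y) <= f (s + 2 * pi) ^+ 2.
  have h0 : 0 <= g * (1 - 2 * pi * y) by rewrite mulr_ge0 ?(ltW g0)//; lra.
  apply: (@le_trans _ _ ((g * (1 - 2 * pi * y)) ^+ 2)).
    rewrite [leRHS]exprMn ler_pM2l ?exprn_gt0//.
    by have := sqr_ge0 (pi * y); lra.
  by rewrite ler_pXn2r ?nnegrE// (le_trans h0).
have F1 : g * s / (1 - al) - 4 * pi * g <= F (s - 2 * pi).
  have h0 : 0 < s - 2 * pi by lra.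
  have /andP[_] := primitive_sub (s - 2 * pi) s h0 ltac:(lra).
  rewrite (primitiveE s)// -/g.
  have /andP[_] := profile_sub (s - 2 * pi) s h0 ltac:(lra).
  rewrite -/g (_ : s - (s - 2 * pi) = 2 * pi); last by ring.
  have D2 : D (s - 2 * pi) <= 4 * g * y.
    apply: le_trans (profile_half s s_gt0); apply: profile_slope_le; lra.
  have : D (s - 2 * pi) * (2 * pi) <= 4 * g * y * (2 * pi).
    by rewrite ler_wpM2r//; lra.
  have : g * (y * (8 * pi)) <= g by rewrite ger_pMr.
  move=> h1 h2 h3.
  have : f (s - 2 * pi) * (2 * pi) <= 2 * g * (2 * pi) by rewrite ler_wpM2r//; lra.
  lra.
have al1' : 1 - al != 0 by rewrite subr_eq0 gt_eqF.
have -> : bnd = g ^+ 2 * ((1 + al) / (1 - al) / 2 - (2 * pi + 4 * pi + C0) * (y + x)).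
  have key (p k c g2 : R) : p != 0 ->
      (p * (1 + al) / (1 - al) - 2 * p * k * c) * g2 / (2 * p) =
      g2 * ((1 + al) / (1 - al) / 2 - k * c).
    by move=> p0; field; rewrite al1' p0.
  by rewrite /bnd /C key// lt0r_neq0.
have F2 : al * g * y * (g * s / (1 - al) - 4 * pi * g - C0) <=
   al * g * y * (F (s - 2 * pi) - C0).
  apply: ler_wpM2l; last exact: lerB.
  exact: ltW (mulr_gt0 (mulr_gt0 al0 g0) y0).
apply: le_trans (lerD (ler_wpM2r _ f2) F2); last by rewrite invr_ge0.
have -> : al * g * y * (g * s / (1 - al) - 4 * pi * g - C0) =
  al * g ^+ 2 * (y * s) / (1 - al) - 4 * pi * al * g ^+ 2 * y - al * g * C0 * (g * x).
  by rewrite gx; ring.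
rewrite ysE.
have -> : (1 + al) / (1 - al) / 2 = 1 / 2 + al / (1 - al) by field.
have g2 : 0 < g ^+ 2 by rewrite exprn_gt0.
have t1 := shrink _ (ltW (mulr_gt0 (mulr_gt0 g2 pp) y0)).
have t2 := shrink _ (ltW (mulr_gt0 (mulr_gt0 g2 C00) x0)).
have t3 := mulr_gt0 (mulr_gt0 g2 pp) x0.
have t4 := mulr_gt0 (mulr_gt0 g2 C00) y0.
have t5 := mulr_gt0 (mulr_gt0 g2 pp) y0.
lra.
Qed.

(** The curve is cut at [S]: the arc before it costs a multiple of [e], and the ray estimate applies
    after it. The term in [1 / S] is [2 * pi * (24 / S) * (al / (1 - al))], the price of the
    enlarged intervals; it does not decrease with [s] and is made small by the choice of [S]. *)
Lemma area_spiral_le (J : set R) (s0 psi S : R) :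
  0 < s0 -> (forall s, J s -> s0 <= s) -> s0 <= S -> 4 * pi <= S ->
  exists2 C, 0 <= C & exists s1, forall s, s1 <= s ->
    (area (eps_nbhd (spiral psi J) (pi * D s)) <=
     ((A0 + 48 * pi * al / (1 - al) / S + C * (s^-1 + (f s * s)^-1)) *
        f s ^+ 2)%:E)%E.
Proof.
move=> s00 Js s0S S4; have pp := @pi_gt0 R; have al_gt0 := al0; have al_lt1 := al1.
have p2 := @pi_ge2 R.
have S0 : 0 < S by lra.
pose J1 := [set s | J s /\ s <= S]; pose J2 := [set s | J s /\ S <= s].
have [C1 C10 head] : exists2 C, 0 <= C & forall e, 0 < e <= 1 ->
    (area (eps_nbhd (spiral psi J1) e) <= (C * e)%:E)%E.
  apply: (area_spiral_head J1 psi s0 S) => // s [/Js s0s sS].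
  by rewrite s0s.
pose C := C1 * pi + 2 * pi * (pi + pi ^+ 2 / 2 + 4 * pi).
have C_ge0 : 0 <= C.
  rewrite /C; have := mulr_ge0 C10 (ltW pp); have := mulr_gt0 pp pp.
  by have := mulr_gt0 (mulr_gt0 pp pp) pp; lra.
(* The summand [pi * f S] ensures [pi * f s <= s], hence [e <= 1], the range in which the head
   estimate holds; [8 * pi] makes [e] small against [f s]. *)
exists C => //; exists (S + 8 * pi + pi * f S) => s s1s.
have fS0 : 0 < f S by exact: profile_gt0.
have piS := mulr_gt0 pp fS0.
have s_gt0 : 0 < s by lra.
set g := f s; have g0 : 0 < g by exact: profile_gt0.
set e := pi * D s; have e0 : 0 < e by rewrite mulr_gt0// profile_slope_gt0.
pose y := s^-1; pose x := (g * s)^-1.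
have y0 : 0 < y by rewrite invr_gt0.
have x0 : 0 < x by rewrite invr_gt0 mulr_gt0.
have ysE : y * s = 1 by rewrite mulVf// gt_eqF.
have gx : g * x = y by rewrite /x invfM mulrA divff ?mul1r// gt_eqF.
have y8 : y * (8 * pi) <= 1.
  by rewrite -[leRHS]ysE ler_pM2l//; lra.
have y1 : y <= 1.
  have := mulr_gt0 y0 pp; have := ler_wpM2l (ltW y0) p2; lra.
have Ds : D s = al * g * y by rewrite profile_slopeE.
have eE : e = pi * (al * (g * y)) by rewrite /e Ds; ring.
have shrink z : 0 <= z -> al * z <= z by move=> z0; rewrite ler_piMl// ltW.
have gy := mulr_gt0 g0 y0.
have e_le : e <= pi * (g * y).
  by rewrite eE ler_pM2l// shrink// ltW.
have gy8 : pi * (g * y) * 8 <= g.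
  rewrite -[leRHS]mulr1; have -> : pi * (g * y) * 8 = g * (y * (8 * pi)) by ring.
  by rewrite ler_pM2l.
have e1 : e <= 1.
  apply: (le_trans e_le).
  have gS : g <= f S by apply: profile_le => //; lra.
  have : pi * g <= s by have := ler_wpM2l (ltW pp) gS; lra.
  by move=> /(ler_wpM2l (ltW y0)); rewrite ysE; lra.
have S24 : 24 / S <= 3 by rewrite ler_pdivrMr//; lra.
have S24_0 : 0 < 24 / S by rewrite divr_gt0.
have fsp : g / 2 <= f (s + pi).
  have /andP[_] := profile_sub s (s + pi) s_gt0 ltac:(lra).
  rewrite -/g Ds (_ : s + pi - s = pi); last by ring.
  by have := shrink _ (ltW (mulr_gt0 gy pp)); lra.
have ray phi : (ray_mass (eps_nbhd (spiral psi J2) e) phi <=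
    ((g + e) ^+ 2 / 2 + e * (1 + 24 / S) / pi * F (s + pi))%:E)%E.
  apply: (ray_mass_spiral_le J2 psi e s S phi) => //; try lra.
  - by move=> t [].
  - rewrite -/g; lra.
  - apply: le_trans fsp.
    have : e * (1 + 24 / S) <= e * 4 by rewrite ler_pM2l//; lra.
    lra.
have sub : eps_nbhd (spiral psi J) e `<=`
    eps_nbhd (spiral psi J1) e `|` eps_nbhd (spiral psi J2) e.
  move=> p [_ [t Jt <-] pt]; have [tS|/ltW St] := leP t S; [left|right].
    by exists (f t * cos (t + psi), f t * sin (t + psi)) => //; exists t.
  by exists (f t * cos (t + psi), f t * sin (t + psi)) => //; exists t.
have mU : measurable (eps_nbhd (spiral psi J1) e `|` eps_nbhd (spiral psi J2) e :
    set (measurableTypeR R * measurableTypeR R)%type).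
  by apply: measurableU; exact: measurable_eps_nbhd.
apply: (le_trans (area_le _ _ (measurable_eps_nbhd _ _) mU sub)).
apply: (le_trans (area_setU _ _ (measurable_eps_nbhd _ _) (measurable_eps_nbhd _ _))).
have h1 := head e ltac:(by rewrite e0 e1).
have h2 := area_le_ray_mass _ _ (measurable_eps_nbhd (spiral psi J2) e) ray.
apply: (le_trans (leeD h1 h2)); rewrite -EFinD lee_fin.
have Fle : F (s + pi) <= g * s / (1 - al) + g * pi.
  have /andP[_] := primitive_sub s (s + pi) s_gt0 ltac:(lra).
  rewrite (primitiveE s)// -/g (_ : s + pi - s = pi); last by ring.
  lra.
have g2 : 0 < g ^+ 2 by rewrite exprn_gt0.
(* Since [e <= pi * g * y] and [y = g * x], the linear cost of the head is a remainder relative to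
   [g ^+ 2]. *)
have c1 : C1 * e <= C1 * pi * g ^+ 2 * x.
  have -> : C1 * pi * g ^+ 2 * x = C1 * (pi * (g * (g * x))) by ring.
  by rewrite gx; exact: ler_wpM2l.
have c2 : (g + e) ^+ 2 <= g ^+ 2 * (1 + (2 * pi + pi ^+ 2) * y).
  apply: (@le_trans _ _ ((g * (1 + pi * y)) ^+ 2)).
    by have pgy := mulr_gt0 pp gy; rewrite ler_pXn2r // ?nnegrE; lra.
  rewrite [leLHS]exprMn ler_pM2l//.
  have : pi ^+ 2 * (y * y) <= pi ^+ 2 * y.
    by rewrite ler_pM2l ?exprn_gt0// ler_piMl// ltW.
  lra.
have q0 : 0 < 1 + 24 / S by lra.
have c3 : e * (1 + 24 / S) / pi * F (s + pi) <=
    g ^+ 2 * ((1 + 24 / S) * (al / (1 - al)) + 4 * pi * y).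
  have -> : e * (1 + 24 / S) / pi = (1 + 24 / S) * (al * (g * y)).
    rewrite eE; have key (p q z : R) : p != 0 -> p * z * q / p = q * z.
      by move=> pz; field.
    by rewrite key// gt_eqF.
  have aq : 0 <= (1 + 24 / S) * (al * (g * y)).
    exact: ltW (mulr_gt0 q0 (mulr_gt0 al0 gy)).
  apply: (le_trans (ler_wpM2l aq Fle)).
  have -> : (1 + 24 / S) * (al * (g * y)) * (g * s / (1 - al) + g * pi) =
    g ^+ 2 * ((1 + 24 / S) * (al / (1 - al)) * (y * s)) +
    (1 + 24 / S) * (al * (g ^+ 2 * pi * y)) by ring.
  rewrite ysE mulr1.
  have gpy := mulr_gt0 (mulr_gt0 g2 pp) y0.
  have : (1 + 24 / S) * (al * (g ^+ 2 * pi * y)) <= 4 * (g ^+ 2 * pi * y).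
    apply: ler_pM; [exact: ltW|exact: ltW (mulr_gt0 al0 gpy)|lra|].
    by apply: shrink; exact: ltW.
  lra.
apply: (@le_trans _ _ (C1 * pi * g ^+ 2 * x + 2 * pi *
  (g ^+ 2 * (1 + (2 * pi + pi ^+ 2) * y) / 2 +
   g ^+ 2 * ((1 + 24 / S) * (al / (1 - al)) + 4 * pi * y)))).
  apply: lerD => //; apply: ler_wpM2l; first lra.
  by apply: lerD => //; rewrite ler_pM2r// invr_gt0.
have al1' : 1 - al != 0 by rewrite subr_eq0 gt_eqF.
have A0E : A0 = pi + 2 * pi * (al / (1 - al)) by field.
have -> : 48 * pi * al / (1 - al) / S = 2 * pi * (24 / S) * (al / (1 - al)) by ring.
rewrite A0E -/y -/x /C.
have t1 : 0 <= C1 * pi * g ^+ 2 * y.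
  exact: mulr_ge0 (mulr_ge0 (mulr_ge0 C10 (ltW pp)) (ltW g2)) (ltW y0).
have t2 := mulr_gt0 (mulr_gt0 (mulr_gt0 pp pp) g2) x0.
have t3 := mulr_gt0 pp t2.
lra.
Qed.

(** Both terms vanish at infinity, the second because [f s * s = b * s^(1 - al)] with [al < 1]. *)
Lemma profile_remainder_small (h : R) : 0 < h ->
  exists2 s1, 0 < s1 & forall s, s1 <= s -> s^-1 + (f s * s)^-1 <= h.
Proof.
move=> h0; have al_lt1 := al1.
have al1' : 0 < 1 - al by lra.
pose K := 2 / h / b; have K0 : 0 < K by rewrite !divr_gt0.
exists (2 / h + K `^ (1 - al)^-1); first by rewrite addr_gt0 ?powR_gt0 ?divr_gt0.
move=> s s1s; have h2 : 0 < 2 / h by rewrite divr_gt0.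
have k0 : 0 < K `^ (1 - al)^-1 by exact: powR_gt0.
have s0 : 0 < s by lra.
have e1 : s^-1 <= h / 2.
  by rewrite -[leRHS]invrK lef_pV2 ?posrE ?invr_gt0 ?divr_gt0// invf_div; lra.
have e2 : (f s * s)^-1 <= h / 2.
  rewrite -[leRHS]invrK lef_pV2 ?posrE ?invr_gt0 ?divr_gt0//; last first.
    by rewrite mulr_gt0// profile_gt0.
  rewrite invf_div.
  have -> : f s * s = b * s `^ (1 - al).
    rewrite (_ : 1 - al = - al + 1); last by ring.
    by rewrite gt0_powRD// powRr1 ?(ltW s0)// mulrA.
  rewrite [leRHS]mulrC -ler_pdivrMr// -/K.
  have -> : K = (K `^ (1 - al)^-1) `^ (1 - al).
    by rewrite -powRrM mulVf ?gt_eqF// powRr1// ltW.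
  apply: ge0_ler_powR; rewrite ?nnegrE ?(ltW al1') ?(ltW k0) ?(ltW s0)//.
  lra.
lra.
Qed.

Lemma area_spiral_asymptotic (J : set R) (s0 psi h : R) :
  0 < s0 -> (forall s, s0 < s -> J s) -> (forall s, J s -> s0 <= s) -> 0 < h ->
  exists2 s1, 0 < s1 & forall s, s1 <= s ->
    (((A0 - h) * f s ^+ 2)%:E <= area (eps_nbhd (spiral psi J) (pi * D s)) <=
     ((A0 + h) * f s ^+ 2)%:E)%E.
Proof.
move=> s00 Js sJ h0; have pp := @pi_gt0 R; have al_lt1 := al1; have al_gt0 := al0.
pose B := 48 * pi * al / (1 - al).
have B0 : 0 < B by rewrite divr_gt0 ?mulr_gt0 ?subr_gt0.
(* Chosen independently of [s], so that [B / S] uses half of [h]; the remainders use the other half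
   once [s] is large. *)
pose S := s0 + 4 * pi + 2 * B / h.
have Bh : 0 < 2 * B / h by apply: divr_gt0 => //; exact: mulr_gt0.
have S0 : 0 < S by rewrite /S; lra.
have BS : B / S <= h / 2.
  rewrite ler_pdivrMr// (_ : B = h / 2 * (2 * B / h)); last by field; rewrite gt_eqF.
  by rewrite ler_pM2l ?divr_gt0// /S; lra.
have [C1 C10 [a1 low]] := area_spiral_ge J s0 psi s00 Js.
have [C2 C20 [a2 upp]] := @area_spiral_le J s0 psi S s00 sJ ltac:(rewrite /S; lra) ltac:(rewrite /S; lra).
pose C := C1 + C2 + 1; have C0 : 0 < C by rewrite /C; lra.
have [a3 a30 small] := @profile_remainder_small (h / 2 / C) ltac:(by rewrite !divr_gt0).
pose m := Num.max a3 (Num.max a1 a2).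
exists m; first by rewrite lt_max a30.
move=> s; rewrite !ge_max => /andP[a3s /andP[a1s a2s]].
have s_gt0 : 0 < s by exact: lt_le_trans a3s.
set z := s^-1 + (f s * s)^-1.
have z0 : 0 < z.
  by apply: addr_gt0; rewrite invr_gt0//; apply: mulr_gt0 => //; exact: profile_gt0.
have Cz : C * z <= h / 2.
  by rewrite mulrC -ler_pdivlMr//; exact: small.
have f2 : 0 < f s ^+ 2 by rewrite exprn_gt0// profile_gt0.
have Cz1 : 0 <= C1 * z by rewrite mulr_ge0// ltW.
have Cz2 : 0 <= C2 * z by rewrite mulr_ge0// ltW.
apply/andP; split.
  apply: le_trans (low s a1s); rewrite lee_fin ler_pM2r// -/z.
  by rewrite /C in Cz; lra.
apply: (le_trans (upp s a2s)); rewrite lee_fin ler_pM2r// -/z -/B.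
by rewrite /C in Cz; lra.
Qed.

(** Solving [pi * D s = e] gives [s = (q / e)^(1 / (al + 1))], and [f s ^+ 2] becomes exactly
    [kap * e^(2 - d)] because [2 - d = 2 * al / (1 + al)]. The Minkowski content is therefore
    [A0 * kap]. *)
Theorem spiral_minkowski (J : set R) (s0 psi : R) :
  0 < s0 -> (forall s, s0 < s -> J s) -> (forall s, J s -> s0 <= s) ->
  let d := 2 / (1 + al) in
  upper_box_dim (spiral psi J) = d%:E /\ lower_box_dim (spiral psi J) = d%:E /\
  minkowski_measurable (spiral psi J).
Proof.
move=> s00 Js sJ d; have pp := @pi_gt0 R; have al_lt1 := al1; have al_gt0 := al0.
pose q := pi * al * b; have q0 : 0 < q by rewrite !mulr_gt0.
pose kap := b ^+ 2 / q `^ (2 - d).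
have kap0 : 0 < kap by rewrite divr_gt0 ?exprn_gt0 ?powR_gt0.
have al1' : 0 < al + 1 by lra.
have A00 : 0 < A0 by rewrite divr_gt0 ?mulr_gt0 ?subr_gt0//; lra.
apply: (@minkowski_criterion _ d (A0 * kap)); first exact: mulr_gt0.
move=> h h0.
have [s1 s10 asym] := @area_spiral_asymptotic J s0 psi (h / kap) s00 Js sJ ltac:(by rewrite divr_gt0).
exists (q * s1 `^ (- (al + 1))); first by rewrite mulr_gt0 ?powR_gt0.
move=> e /andP[e0 es1].
pose s := (q / e) `^ (al + 1)^-1.
have qe0 : 0 < q / e by rewrite divr_gt0.
have s_gt0 : 0 < s by exact: powR_gt0.
have sal : s `^ (al + 1) = q / e.
  by rewrite /s -powRrM mulVf ?gt_eqF// powRr1// ltW.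
have De : pi * D s = e.
  rewrite /profile_slope (_ : - al - 1 = - (al + 1)); last by ring.
  rewrite powRN sal invf_div /q.
  have key (x : R) : x != 0 -> x * (e / x) = e by move=> xn; field.
  by rewrite !mulrA -(mulrA _ e) key// gt_eqF// !mulr_gt0.
have s1s : s1 <= s.
  have -> : s1 = (s1 `^ (al + 1)) `^ (al + 1)^-1.
    by rewrite -powRrM mulfV ?gt_eqF// powRr1// ltW.
  have p1 : 0 < s1 `^ (al + 1) by exact: powR_gt0.
  apply: ge0_ler_powR; rewrite ?nnegrE ?invr_ge0 ?(ltW al1') ?(ltW p1) ?(ltW qe0)//.
  move: es1; rewrite powRN ltr_pdivlMr// => /ltW es1.
  by rewrite ler_pdivlMr// mulrC.
have f2 : f s ^+ 2 = kap * e `^ (2 - d).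
  have -> : f s ^+ 2 = b ^+ 2 * s `^ (- (al + 1) * (2 - d)).
    rewrite exprMn -(powR_mulrn 2 (powR_ge0 s (- al))) -powRrM; congr (_ * _ `^ _).
    by rewrite /d; field; rewrite gt_eqF//; lra.
  rewrite powRrM powRN sal invf_div powRM ?(ltW e0) ?invr_ge0 ?(ltW q0)//.
  rewrite -(powR_inv1 (ltW q0)) -powRrM mulN1r powRN /kap; ring.
have key (x : R) : (A0 + x / kap) * (kap * e `^ (2 - d)) = (A0 * kap + x) * e `^ (2 - d).
  by rewrite mulrA mulrDl divfK// gt_eqF.
by have := asym s s1s; rewrite De f2 -mulNr !key.
Qed.

End power_profile.

(** * Curves converging exponentially fast *)

Section derivatives.
Context {R : realType}.
Implicit Types (f g : R -> R) (t df dg c : R).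

Lemma is_derive_add f g t df dg : is_derive t 1 f df -> is_derive t 1 g dg ->
  is_derive t 1 (fun s => f s + g s) (df + dg).
Proof. by move=> hf hg; exact: is_deriveD. Qed.

Lemma is_derive_mul f g t df dg : is_derive t 1 f df -> is_derive t 1 g dg ->
  is_derive t 1 (fun s => f s * g s) (df * g t + f t * dg).
Proof.
move=> hf hg; have := is_deriveM hf hg; rewrite /GRing.scale/=.
by rewrite addrC (mulrC (g t)).
Qed.

Lemma is_derive_scale f t df c : is_derive t 1 f df ->
  is_derive t 1 (fun s => c * f s) (c * df).
Proof. by move=> hf; exact: is_deriveZ. Qed.

Lemma is_derive_inv f t df : f t != 0 -> is_derive t 1 f df ->
  is_derive t 1 (fun s => (f s)^-1) (- df / f t ^+ 2).
Proof.
move=> ft hf; have := is_deriveV ft hf; rewrite /GRing.scale/=.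
by rewrite (_ : - df / f t ^+ 2 = - f t ^- 2 * df)//; ring.
Qed.

Lemma is_derive_pow f t df (n : nat) : is_derive t 1 f df ->
  is_derive t 1 (fun s => f s ^+ n) (n%:R * f t ^+ n.-1 * df).
Proof.
move=> hf; have := @is_deriveX _ _ f n t 1 df hf; rewrite /GRing.scale/=.
by rewrite (_ : f ^+ n = (fun s => f s ^+ n))//; apply/funext => s; rewrite exprfctE.
Qed.

Lemma interval_cst (J : set R) f : is_interval J ->
  (forall t, J t -> is_derive t 1 f 0) -> forall s t, J s -> J t -> f s = f t.
Proof.
move=> iJ df s t; wlog st : s t / s <= t.
  move=> h Js Jt; have [st|/ltW ts] := leP s t; first exact: h.
  by apply/esym; exact: h.
move=> Js Jt.
have [|c _ /eqP] := @mvt_is_derive _ f (fun=> 0) s t st.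
  by move=> u /andP[su ut]; apply: df; apply: (iJ s t) => //; rewrite su ut.
by rewrite mul0r subr_eq0 => /eqP.
Qed.

End derivatives.

Section dimension_one.
Context {R : realType}.
Local Notation mu := (@lebesgue_measure R).
Local Notation T := (measurableTypeR R).
Implicit Types (X Y : R -> R) (J : set R).

(** By the intermediate value theorem each vertical line between [X t1] and [X t2] meets the curve,
    and there the neighbourhood contains a segment of length [2 * e]. This yields dimension at least
    [1] for a curve with nonconstant abscissa. *)
Lemma area_eps_nbhd_ge X Y (dX : R -> R) J (e t1 t2 : R) :
  is_interval J -> (forall t, J t -> is_derive t 1 X (dX t)) -> J t1 -> J t2 ->
  0 < e -> X t1 <= X t2 ->
  ((2 * e * (X t2 - X t1))%:E <= area (eps_nbhd [set (X t, Y t) | t in J] e))%E.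
Proof.
move=> iJ hX J1 J2 e0 X12.
set A := eps_nbhd _ e.
have mA : measurable (A : set (T * T)%type) by exact: measurable_eps_nbhd.
have hit v : X t1 <= v <= X t2 -> exists2 t, J t & X t = v.
  move=> /andP[v1 v2].
  have sub s t : J s -> J t -> {within `[s, t], continuous X}.
    move=> Js Jt; apply: derivable_within_continuous => u; rewrite in_itv/= => ust.
    by have := hX _ (iJ _ _ Js Jt _ ust) => ?; exact: ex_derive.
  have [t12|/ltW t21] := leP t1 t2.
    have [|c] := @IVT _ X t1 t2 v t12 (sub _ _ J1 J2).
      by rewrite min_l// max_r// v1.
    by rewrite in_itv/= => ct Xc; exists c => //; exact: (iJ _ _ J1 J2).
  have [|c] := @IVT _ X t2 t1 v t21 (sub _ _ J2 J1).
    by rewrite min_r// max_l// v1.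
  by rewrite in_itv/= => ct Xc; exists c => //; exact: (iJ _ _ J2 J1).
have -> : (2 * e * (X t2 - X t1))%:E =
    (\int[mu]_x ((2 * e)%:E * (\1_(`[X t1, X t2]%classic : set R) x)%:E))%E.
  rewrite ge0_integralZl_EFin//; last 2 first.
  - by apply/measurable_EFinP; exact: measurable_indic.
  - by rewrite mulr_ge0// ltW.
  rewrite integral_indic//= setIT lebesgue_measure_itv/= lte_fin.
  move: X12; rewrite le_eqVlt => /predU1P[->|->]; last by rewrite -EFinB -EFinM.
  by rewrite ltxx subrr mulr0 mule0.
apply: ge0_le_integral => //.
- by move=> x _; rewrite mule_ge0// lee_fin ?mulr_ge0// ltW.
- apply/measurable_EFinP/measurable_funM => //; exact: measurable_indic.
- exact: measurable_fun_xsection.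
move=> x _ /=; rewrite indicE; case: (boolP (_ \in _)) => [|_]; last first.
  by rewrite mule0; exact: measure_ge0.
rewrite inE/= in_itv/= mule1 => /hit[t Jt Xt].
have -> : (2 * e)%:E = mu `]Y t - e, Y t + e[%classic.
  rewrite lebesgue_measure_itv/= lte_fin ifT; last lra.
  by rewrite -EFinB; congr EFin; ring.
apply: le_measure; rewrite ?inE//.
  exact: measurable_xsection.
move=> z /=; rewrite in_itv/= => /andP[z1 z2]; rewrite /xsection/= inE.
exists (X t, Y t); first by exists t.
apply: le_lt_trans (edist_le _ _) _.
by rewrite /= Xt subrr normr0 add0r ltr_norml; apply/andP; split; lra.
Qed.

(** The value [r = 0] gives the origin, so both possible limit sets are instances of this one. *)
Definition circle (r : R) : set (R * R) :=
  [set (r * cos t, r * sin t) | t in `[0, 2 * pi] ].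

Lemma derivable_lipschitz J X (dX : R -> R) (L : R) : is_interval J ->
  (forall t, J t -> is_derive t 1 X (dX t)) -> (forall t, J t -> `|dX t| <= L) ->
  forall s t, J s -> J t -> `|X s - X t| <= L * `|s - t|.
Proof.
move=> iJ hX hL s t; wlog st : s t / s <= t.
  move=> h Js Jt; have [st|/ltW ts] := leP s t; first exact: h.
  by rewrite distrC (distrC s); exact: h.
move=> Js Jt; have [|c cst h] := @mvt_is_derive _ X dX s t st.
  by move=> u /(iJ _ _ Js Jt); exact: hX.
rewrite distrC h normrM (distrC s); apply: ler_wpM2r => //.
exact/hL/(iJ _ _ Js Jt).
Qed.

(** The radius is [c * e] because a curve point within [C * e] of the circle carries its own disc of
    radius [e]; the application takes [c = C + 1]. *)
Lemma area_eps_nbhd_circle (r : R) : 0 <= r ->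
  exists2 C, 0 <= C & forall e, 0 < e <= 1 -> forall c, 1 <= c ->
    (area (eps_nbhd (circle r) (c * e)) <= (C * c ^+ 2 * e)%:E)%E.
Proof.
move=> r0; have pp := @pi_gt0 R.
exists (4 * (r + 1) ^+ 2 * (2 * pi + 1)).
  by rewrite mulr_ge0 ?mulr_ge0 ?sqr_ge0//; lra.
move=> e /andP[e0 e1] c c1.
have ce0 : 0 < c * e by rewrite mulr_gt0//; lra.
have iJ : is_interval (`[0, 2 * pi]%classic : set R) by exact: interval_is_interval.
apply: (le_trans (area_eps_nbhd_lipschitz _ (fun t => r * cos t) (fun t => r * sin t)
  0 (2 * pi) r (c * e) _ _ _ _ _ _)) => //; first lra.
- apply: (derivable_lipschitz _ (fun t => r * cos t) (fun t => r * - sin t)) => // t _.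
  by rewrite normrM ger0_norm// normrN ler_piMr// ler_norml sin_geN1 sin_le1.
- apply: (derivable_lipschitz _ (fun t => r * sin t) (fun t => r * cos t)) => // t _.
  by rewrite normrM ger0_norm// ler_piMr// ler_norml cos_geN1 cos_le1.
- rewrite lee_fin subr0.
  set K := 4 * (r + 1) ^+ 2; have K0 : 0 <= K by rewrite mulr_ge0 ?sqr_ge0.
  have -> : K * (2 * pi + c * e) * (c * e) = K * (c * e) * (2 * pi + c * e) by ring.
  have -> : K * (2 * pi + 1) * c ^+ 2 * e = K * (c * e) * (2 * pi * c + c) by ring.
  apply: ler_wpM2l; first by rewrite mulr_ge0// ltW.
  have h1 : c * e <= c by rewrite ler_piMr//; lra.
  by have := ler_wpM2l (ltW pp) c1; lra.
Qed.

Lemma near_circle (r t : R) (p : R * R) (e : R) :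
  edist p (r * cos t, r * sin t) < e -> eps_nbhd (circle r) e p.
Proof.
move=> pe; have [u [u0 u2 cu su]] := angle_representative 0 t 0.
exists (r * cos t, r * sin t) => //; exists u.
  by rewrite /= in_itv/= (ltW u0) -[X in _ <= X]add0r.
by rewrite -cu -su addr0.
Qed.

(** Decay in |t| treats both ends of [J] at once. The two ends may have different limits, the origin
    and a circle, so [rho] is chosen for each [t]. *)
Lemma curve_dim_one X Y (dX dY : R -> R) J (L C kappa r : R) t1 t2 :
  is_interval J -> (forall t, J t -> is_derive t 1 X (dX t)) ->
  (forall t, J t -> is_derive t 1 Y (dY t)) ->
  (forall t, J t -> `|dX t| <= L) -> (forall t, J t -> `|dY t| <= L) ->
  J t1 -> J t2 -> X t1 < X t2 -> 0 <= r -> 0 <= C -> 0 < kappa ->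
  (forall t, J t -> exists2 rho, rho = 0 \/ rho = r & exists u,
     edist (X t, Y t) (rho * cos u, rho * sin u) <= C * expR (- (kappa * `|t|))) ->
  let B := [set (X t, Y t) | t in J] in
  upper_box_dim B = 1%:E /\ lower_box_dim B = 1%:E.
Proof.
move=> iJ hX hY LX LY J1 J2 X12 r0 C0 kap0 tail B.
have L0 : 0 <= L by exact: le_trans (LX _ J1).
apply: box_dim_criterion.
  exists (2 * (X t2 - X t1)); first by rewrite mulr_gt0// subr_gt0.
  exists 1 => // e /andP[e0 _].
  rewrite (_ : 2 - 1 = 1); last by ring.
  rewrite powRr1 ?(ltW e0)// mulrAC.
  exact: (area_eps_nbhd_ge _ _ dX _ _ _ _ iJ hX J1 J2 e0 (ltW X12)).
move=> h h0.
have [C1 C10 circ0] := area_eps_nbhd_circle 0 (lexx 0).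
have [C2 C20 circr] := area_eps_nbhd_circle r r0.
pose K := 4 * (L + 1) ^+ 2; have K0 : 0 <= K by rewrite mulr_ge0 ?sqr_ge0.
pose c := C + 1; have c1 : 1 <= c by rewrite /c; lra.
exists (K * (2 / (kappa * h) + 1) + C1 * c ^+ 2 + C2 * c ^+ 2), 1 => //.
move=> e /andP[e0 e1].
pose lam := ln e^-1.
have lam0 : 0 <= lam by rewrite ln_ge0// invf_ge1// ltW.
have elam : expR (- lam) = e by rewrite /lam lnV ?posrE// opprK lnK.
pose Tm := lam / kappa; have Tm0 : 0 <= Tm by rewrite divr_ge0// ltW.
pose S := J `&` `[- Tm, Tm]%classic.
have sub : eps_nbhd B e `<=` eps_nbhd [set (X t, Y t) | t in S] e `|`
    (eps_nbhd (circle 0) (c * e) `|` eps_nbhd (circle r) (c * e)).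
  move=> p [_ [t Jt <-] pt]; have [tT|Tt] := leP `|t| Tm.
    left; exists (X t, Y t) => //; exists t => //; split=> //.
    by rewrite /= in_itv/= -ler_norml.
  right; have [rho hrho [u hu]] := tail t Jt.
  have pu : edist p (rho * cos u, rho * sin u) < c * e.
    apply: le_lt_trans (edist_triangle _ (X t, Y t) _) _.
    have : C * expR (- (kappa * `|t|)) <= C * e.
      rewrite ler_wpM2l// -elam ler_expR lerN2.
      by move: Tt; rewrite /Tm ltr_pdivrMr// mulrC => /ltW.
    by rewrite /c; lra.
  by case: hrho pu => -> pu; [left|right]; exact: near_circle pu.
have mN B' e' := measurable_eps_nbhd (R := R) B' e'.
have mU2 : measurable (eps_nbhd (circle 0) (c * e) `|` eps_nbhd (circle r) (c * e) :
  set (T * T)%type) by apply: measurableU; exact: mN.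
have mU : measurable (eps_nbhd [set (X t, Y t) | t in S] e `|`
    (eps_nbhd (circle 0) (c * e) `|` eps_nbhd (circle r) (c * e)) :
  set (T * T)%type) by apply: measurableU; [exact: mN|exact: mU2].
apply: (le_trans (area_le _ _ (mN _ _) mU sub)).
apply: (le_trans (area_setU _ _ (mN _ _) mU2)).
apply: (le_trans (leeD (le_refl _) (area_setU _ _ (mN _ _) (mN _ _)))).
have e01 : 0 < e <= 1 by rewrite e0 ltW.
have b1 : (area (eps_nbhd [set (X t, Y t) | t in S] e) <=
    (K * (Tm - - Tm + e) * e)%:E)%E.
  apply: area_eps_nbhd_lipschitz => //.
  - lra.
  - by move=> t [_]; rewrite /= in_itv.
  - by move=> s t [Js _] [Jt _]; exact: (derivable_lipschitz _ _ _ _ iJ hX LX).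
  - by move=> s t [Js _] [Jt _]; exact: (derivable_lipschitz _ _ _ _ iJ hY LY).
apply: (le_trans (leeD b1 (leeD (circ0 _ e01 _ c1) (circr _ e01 _ c1)))).
rewrite -!EFinD lee_fin.
set E := e `^ (2 - (1 + h)).
have E0 : 0 < E by exact: powR_gt0.
have eE : e <= E.
  rewrite -[leLHS](powRr1 (ltW e0)) /E ger_powR ?e0 ?(ltW e1)//; lra.
(* The logarithm is absorbed by the extra power: [h * lam <= expR (h * lam) = e^(- h)]. *)
have lamE : lam * e <= E / h.
  rewrite ler_pdivlMr// /E (_ : 2 - (1 + h) = - h + 1); last by ring.
  rewrite gt0_powRD// powRr1 ?(ltW e0)// mulrAC ler_pM2r//.
  rewrite -[in leRHS]elam -expRM mulrNN.
  by apply: le_trans (expR_ge1Dx _); rewrite lerDr.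
have t1' : Tm * e <= E / (kappa * h).
  rewrite /Tm mulrAC ler_pdivrMr//; apply: (le_trans lamE).
  by rewrite (_ : E / (kappa * h) * kappa = E / h)//; field; rewrite !lt0r_neq0.
have t2' : e * e <= E by apply: le_trans eE; rewrite ler_piMl// ltW.
have h1 : K * (Tm - - Tm + e) * e <= K * (2 / (kappa * h) + 1) * E.
  have -> : K * (Tm - - Tm + e) * e = K * (2 * (Tm * e) + e * e) by ring.
  have -> : K * (2 / (kappa * h) + 1) * E = K * (2 * (E / (kappa * h)) + E) by ring.
  by apply: ler_wpM2l => //; lra.
have h2 : C1 * c ^+ 2 * e <= C1 * c ^+ 2 * E.
  by apply: ler_wpM2l => //; rewrite mulr_ge0 ?sqr_ge0.
have h3 : C2 * c ^+ 2 * e <= C2 * c ^+ 2 * E.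
  by apply: ler_wpM2l => //; rewrite mulr_ge0 ?sqr_ge0.
lra.
Qed.

End dimension_one.

(** * The inverted trajectory *)

Section trajectory.
Context {R : realType}.
Context (k : nat) (a : R) (x y : R -> R) (J : set R) (k_gt0 : (0 < k)%N)
  (traj : unbounded_spiral_trajectory k a x y J).
Implicit Types (t : R).

Definition sqrad t := x t ^+ 2 + y t ^+ 2.
Definition powrad t := sqrad t ^+ k.
Definition rate t := (powrad t)^-1 + a.

Local Notation q := sqrad.
Local Notation p := powrad.
Local Notation w := rate.

Lemma trajectory_interval : is_interval J. Proof. by case: traj. Qed.

Lemma is_derive_x t : J t -> is_derive t 1 x (- y t + x t * w t).
Proof. by case: traj => _ h _ _ _ /h []. Qed.

Lemma is_derive_y t : J t -> is_derive t 1 y (x t + y t * w t).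
Proof. by case: traj => _ h _ _ _ /h []. Qed.

Lemma powrad_bounded_below : exists2 m, 0 < m & forall t, J t -> m <= p t.
Proof.
case: traj => _ _ _ _ [d d0 hd]; exists ((d ^+ 2) ^+ k); first by rewrite !exprn_gt0.
move=> t /hd; rewrite /Defs.edist/= !subr0 => dt.
rewrite lerXn2r ?nnegrE ?sqr_ge0 ?addr_ge0 ?sqr_ge0//.
have q0 : 0 <= q t by rewrite addr_ge0 ?sqr_ge0.
by rewrite -(sqr_sqrtr q0) ler_pXn2r ?nnegrE ?sqrtr_ge0 ?(ltW d0).
Qed.

Lemma powrad_gt0 t : J t -> 0 < p t.
Proof. by case: powrad_bounded_below => m m0 hm /hm; exact: lt_le_trans. Qed.

Lemma sqrad_gt0 t : J t -> 0 < q t.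
Proof.
move=> /powrad_gt0 pt; have q0 : 0 <= q t by apply: addr_ge0; exact: sqr_ge0.
rewrite lt_neqAle q0 andbT; apply/eqP => qt.
by move: pt; rewrite /powrad -qt expr0n eqn0Ngt k_gt0 ltxx.
Qed.

Lemma is_derive_sqrad t : J t -> is_derive t 1 q (2 * q t * w t).
Proof.
move=> Jt; have hx := is_derive_x t Jt; have hy := is_derive_y t Jt.
have := is_derive_add _ _ _ _ _ (is_derive_pow _ _ _ 2 hx) (is_derive_pow _ _ _ 2 hy).
rewrite (_ : 2%:R * x t ^+ 2.-1 * _ + _ = 2 * q t * w t)//.
by rewrite /sqrad /= !expr1; ring.
Qed.

Lemma is_derive_powrad t : J t -> is_derive t 1 p (2 * k%:R * (1 + a * p t)).
Proof.
move=> Jt; have := is_derive_pow _ _ _ k (is_derive_sqrad t Jt).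
rewrite (_ : k%:R * q t ^+ k.-1 * _ = 2 * k%:R * (1 + a * p t))//.
have p0 := powrad_gt0 t Jt.
have -> : k%:R * q t ^+ k.-1 * (2 * q t * w t) = 2 * k%:R * (p t * w t).
  by rewrite /powrad -(prednK k_gt0) exprS prednK//; ring.
by rewrite /rate mulrDr mulfV ?gt_eqF// (mulrC _ a).
Qed.

Lemma powrad_unbounded (M : R) : exists2 t, J t & M < p t.
Proof.
case: traj => _ _ _ unb _; have [t Jt ht] := unb (2 * (`|M| + 1)).
exists t => //; have M0 := normr_ge0 M.
have q1 : `|M| + 1 <= q t.
  have hq : (`|x t| + `|y t|) ^+ 2 <= 2 * q t.
    rewrite /sqrad -(real_normK (num_real (x t))) -(real_normK (num_real (y t))).
    by have := sqr_ge0 (`|x t| - `|y t|); lra.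
  have : (2 * (`|M| + 1)) ^+ 2 <= (`|x t| + `|y t|) ^+ 2.
    by rewrite ler_pXn2r ?nnegrE ?addr_ge0 ?mulr_ge0 ?(ltW ht)//; lra.
  have := mulr_ge0 M0 M0; lra.
have qp : q t <= p t.
  by rewrite /powrad ler_eXnr//; lra.
by have := ler_norm M; lra.
Qed.

(** [u1] and [u2] are the coordinates of the unit vector along [(x, y)] rotated by [- t]. Their
    derivatives vanish, so they are constant on [J], and the polar form at [t0] identifies them with
    [cos psi] and [sin psi]. *)
Lemma polar_angle : exists psi, forall t, J t ->
  x t = Num.sqrt (q t) * cos (t + psi) /\ y t = Num.sqrt (q t) * sin (t + psi).
Proof.
have [t0 Jt0 _] := powrad_unbounded 0.
case: (traj) => _ _ [theta [rho [hrho _ _ _ _]]] _ _.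
have [rho0 [hx0 hy0]] := hrho _ Jt0.
pose psi := theta t0 - t0; exists psi => t Jt.
pose u1 s := (Num.sqrt (q s))^-1 * (x s * cos s + y s * sin s).
pose u2 s := (Num.sqrt (q s))^-1 * (y s * cos s - x s * sin s).
have dr s : J s -> is_derive s 1 (fun z => (Num.sqrt (q z))^-1) (- (Num.sqrt (q s))^-1 * w s).
  move=> Js; have q0 := sqrad_gt0 s Js.
  have r0 : 0 < Num.sqrt (q s) by rewrite sqrtr_gt0.
  have h := @is_derive1_comp _ Num.sqrt q s _ _ (is_derive1_sqrt q0) (is_derive_sqrad s Js).
  have := is_derive_inv (Num.sqrt \o q) s _ (lt0r_neq0 r0) h.
  rewrite (_ : - _ / _ = - (Num.sqrt (q s))^-1 * w s)//=.
  set r := Num.sqrt (q s); have -> : q s = r ^+ 2 by rewrite sqr_sqrtr// ltW.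
  by field; rewrite lt0r_neq0.
have ur s : J s -> Num.sqrt (q s) != 0.
  by move=> Js; rewrite lt0r_neq0// sqrtr_gt0 sqrad_gt0.
have d1 s : J s -> is_derive s 1 u1 0.
  move=> Js; have hx := is_derive_x s Js; have hy := is_derive_y s Js.
  have h := is_derive_add _ _ _ _ _ (is_derive_mul _ _ _ _ _ hx (is_derive_cos s))
    (is_derive_mul _ _ _ _ _ hy (is_derive_sin s)).
  have := is_derive_mul _ _ _ _ _ (dr s Js) h.
  by rewrite (_ : - _ * _ * _ + _ = 0)//; ring.
have d2 s : J s -> is_derive s 1 u2 0.
  move=> Js; have hx := is_derive_x s Js; have hy := is_derive_y s Js.
  have h := is_derive_add _ _ _ _ _ (is_derive_mul _ _ _ _ _ hy (is_derive_cos s))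
    (is_derive_scale _ _ _ (-1) (is_derive_mul _ _ _ _ _ hx (is_derive_sin s))).
  have := is_derive_mul _ _ _ _ _ (dr s Js) h.
  rewrite (_ : (fun z : R => _) = u2); last first.
    by apply/funext => z; rewrite /u2 mulN1r.
  by rewrite (_ : - _ * _ * _ + _ = 0)//; ring.
have c1 := interval_cst J u1 trajectory_interval d1 t t0 Jt Jt0.
have c2 := interval_cst J u2 trajectory_interval d2 t t0 Jt Jt0.
have sq0 : Num.sqrt (q t0) = rho t0.
  rewrite /sqrad hx0 hy0 !exprMn -mulrDr cos2Dsin2 mulr1 sqrtr_sqr gtr0_norm//.
have e1 : u1 t = cos psi.
  rewrite c1 /u1 sq0 hx0 hy0 /psi cosB.
  by field; rewrite gt_eqF.
have e2 : u2 t = sin psi.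
  rewrite c2 /u2 sq0 hx0 hy0 /psi sinB.
  by field; rewrite gt_eqF.
have rt := ur t Jt; have cs := cos2Dsin2 t.
rewrite cosD sinD -e1 -e2 /u1 /u2; split.
  transitivity (x t * (cos t ^+ 2 + sin t ^+ 2)); first by rewrite cs mulr1.
  by field.
transitivity (y t * (cos t ^+ 2 + sin t ^+ 2)); first by rewrite cs mulr1.
by field.
Qed.

Local Notation al := ((2 * k)%:R^-1 : R).

Lemma exponent_gt0 : 0 < al.
Proof. by rewrite invr_gt0 ltr0n muln_gt0. Qed.

Lemma exponent_lt1 : al < 1.
Proof. by rewrite invf_lt1 ?ltr0n ?ltr1n ?muln_gt0// (@leq_mul 2 1 2 k). Qed.

Lemma powrad_radius t : J t -> p t `^ (- al) = (Num.sqrt (q t))^-1.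
Proof.
move=> /sqrad_gt0 q0; rewrite powRN; congr _^-1.
rewrite /powrad -(powR_mulrn k (ltW q0)) -powRrM.
rewrite (_ : k%:R * al = 2^-1); first by rewrite powR12_sqrt// ltW.
by rewrite natrM; field; rewrite pnatr_eq0 -lt0n.
Qed.

Definition inv_x t := x t / q t.
Definition inv_y t := y t / q t.

Lemma inversion_image :
  @inversion R @` [set (x t, y t) | t in J] = [set (inv_x t, inv_y t) | t in J].
Proof.
apply/seteqP; split=> [_ [_ [t Jt <-] <-]|_ [t Jt <-]]; first by exists t.
by exists (x t, y t) => //; exists t.
Qed.

Lemma inversion_polar : exists psi, forall t, J t ->
  inv_x t = p t `^ (- al) * cos (t + psi) /\ inv_y t = p t `^ (- al) * sin (t + psi).
Proof.
have [psi h] := polar_angle; exists psi => t Jt.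
have [hx hy] := h t Jt; have q0 := sqrad_gt0 t Jt.
have r0 : Num.sqrt (q t) != 0 by rewrite lt0r_neq0// sqrtr_gt0.
have E (c : R) : Num.sqrt (q t) * c / q t = (Num.sqrt (q t))^-1 * c.
  have key (r : R) : r != 0 -> r * c / r ^+ 2 = r^-1 * c by move=> rn; field.
  by rewrite -key// sqr_sqrtr// ltW.
by rewrite powrad_radius// /inv_x /inv_y hx hy !E.
Qed.

Lemma is_derive_inv_x t : J t -> is_derive t 1 inv_x (- inv_y t - inv_x t * w t).
Proof.
move=> Jt; have q0 := sqrad_gt0 t Jt; have qn := lt0r_neq0 q0.
have := is_derive_mul _ _ _ _ _ (is_derive_x t Jt)
  (is_derive_inv _ _ _ qn (is_derive_sqrad t Jt)).
rewrite (_ : _ / q t + _ = - inv_y t - inv_x t * w t)//.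
by rewrite /inv_x /inv_y; field.
Qed.

Lemma is_derive_inv_y t : J t -> is_derive t 1 inv_y (inv_x t - inv_y t * w t).
Proof.
move=> Jt; have q0 := sqrad_gt0 t Jt; have qn := lt0r_neq0 q0.
have := is_derive_mul _ _ _ _ _ (is_derive_y t Jt)
  (is_derive_inv _ _ _ qn (is_derive_sqrad t Jt)).
rewrite (_ : _ / q t + _ = inv_x t - inv_y t * w t)//.
by rewrite /inv_x /inv_y; field.
Qed.

Lemma inversion_speed_bounded : exists L, forall t, J t ->
  `|- inv_y t - inv_x t * w t| <= L /\ `|inv_x t - inv_y t * w t| <= L.
Proof.
have [m m0 hm] := powrad_bounded_below; have [psi hpsi] := inversion_polar.
pose r := m `^ (- al); exists (r + r * (m^-1 + `|a|)) => t Jt.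
have [hx hy] := hpsi t Jt; have p0 := powrad_gt0 t Jt.
have rt : p t `^ (- al) <= r by apply: powRN_le; rewrite ?hm// ltW// exponent_gt0.
have bnd (c : R) : `|c| <= 1 -> `|p t `^ (- al) * c| <= r.
  move=> c1; rewrite normrM ger0_norm ?powR_ge0// -[leRHS]mulr1.
  by apply: ler_pM => //; exact: powR_ge0.
have bx : `|inv_x t| <= r by rewrite hx bnd// ler_norml cos_geN1 cos_le1.
have by_ : `|inv_y t| <= r by rewrite hy bnd// ler_norml sin_geN1 sin_le1.
have bw : `|w t| <= m^-1 + `|a|.
  apply: (le_trans (ler_normD _ _)); rewrite lerD2r gtr0_norm ?invr_gt0//.
  by rewrite lef_pV2 ?posrE// hm.
have bm u : `|u| <= r -> `|u * w t| <= r * (m^-1 + `|a|).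
  by move=> ur; rewrite normrM; apply: ler_pM.
split; apply: (le_trans (ler_normB _ _)); apply: lerD; rewrite ?normrN//; exact: bm.
Qed.

(** A time span of a full turn contains a point on the positive and a point on the negative
    horizontal half-axis. *)
Lemma inversion_nonconstant t t' : J t -> J t' -> t + 2 * pi <= t' ->
  exists t1 t2, [/\ J t1, J t2 & inv_x t1 < inv_x t2].
Proof.
move=> Jt Jt' tt'; have [psi hpsi] := inversion_polar.
have sub u : t < u -> u <= t + 2 * pi -> J u.
  move=> tu ut; apply: (trajectory_interval t t') => //.
  by rewrite (ltW tu) (le_trans ut).
have [u [u1 u2 cu _]] := angle_representative t 0 psi.
have [v [v1 v2 cv _]] := angle_representative t pi psi.
exists v, u; split; [exact: sub|exact: sub|].
have [-> _] := hpsi u (sub u u1 u2); have [-> _] := hpsi v (sub v v1 v2).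
rewrite cu cv cos0 cospi mulrN !mulr1.
have := powR_gt0 (- al) (powrad_gt0 _ (sub u u1 u2)).
have := powR_gt0 (- al) (powrad_gt0 _ (sub v v1 v2)); lra.
Qed.

(** * Closed form of [p] and the three signs of [a] *)

Lemma first_integral : exists c, forall t, J t ->
  1 + a * p t = c * expR (2 * k%:R * a * t).
Proof.
have [t0 Jt0 _] := powrad_unbounded 0.
pose lam := 2 * k%:R * a.
pose G t := (1 + a * p t) * expR (- lam * t).
have dG t : J t -> is_derive t 1 G 0.
  move=> Jt.
  have h1 := is_derive_add _ _ _ _ _ (is_derive_cst (1 : R) t 1)
    (is_derive_scale _ _ _ a (is_derive_powrad t Jt)).
  have h2 := is_derive_scale _ _ _ (- lam) (is_derive_id t 1).
  have h3 := @is_derive1_comp _ expR _ t _ _ (is_derive_expR _) h2.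
  have := is_derive_mul _ _ _ _ _ h1 h3.
  by rewrite (_ : _ + _ = 0)// /lam/=; ring.
exists (G t0) => t Jt.
rewrite -(interval_cst J G trajectory_interval dG t t0 Jt Jt0) /G -/lam.
by rewrite -mulrA -expRD mulNr addNr expR0 mulr1.
Qed.

Lemma powRV_le (u v : R) : 0 < u -> u^-1 <= v -> u `^ (- al) <= v `^ al.
Proof.
move=> u0 uv; have v0 : 0 < v by apply: lt_le_trans uv; rewrite invr_gt0.
rewrite -mulN1r powRrM (powR_inv1 (ltW u0)).
apply: ge0_ler_powR; rewrite ?nnegrE ?invr_ge0 ?(ltW u0) ?(ltW v0)//.
Qed.

Lemma expR_exponent (z : R) : expR (2 * k%:R * z) `^ al = expR z.
Proof.
rewrite -expRM; congr expR; rewrite natrM; field.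
by rewrite pnatr_eq0 -lt0n.
Qed.

Lemma edist_inversion psi (rho : R) t :
  inv_x t = p t `^ (- al) * cos (t + psi) -> inv_y t = p t `^ (- al) * sin (t + psi) ->
  edist (inv_x t, inv_y t) (rho * cos (t + psi), rho * sin (t + psi)) =
  `|p t `^ (- al) - rho|.
Proof. by move=> -> ->; exact: edist_ray. Qed.

(** Since [c * expR (2 * k * a * t) = 1 + a * p > 1], time is bounded below by [tm]; the only
    unbounded end is the future, where the inverted curve tends to the origin. *)
Lemma dim_one_expanding : 0 < a ->
  upper_box_dim [set (inv_x t, inv_y t) | t in J] = 1%:E /\
  lower_box_dim [set (inv_x t, inv_y t) | t in J] = 1%:E.
Proof.
move=> a0; have [c hc] := first_integral; have [m m0 hm] := powrad_bounded_below.
have [psi hpsi] := inversion_polar; have [L hL] := inversion_speed_bounded.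
have k0 : 0 < k%:R :> R by rewrite ltr0n.
have lam0 : 0 < 2 * k%:R * a by rewrite !mulr_gt0.
have [t0 Jt0 _] := powrad_unbounded 0.
have c0 : 0 < c.
  have : 0 < c * expR (2 * k%:R * a * t0).
    by rewrite -hc// addr_gt0// mulr_gt0// powrad_gt0.
  by rewrite pmulr_lgt0// expR_gt0.
have [t1 Jt1 ht1] := powrad_unbounded (c * expR (2 * k%:R * a * (t0 + 2 * pi)) / a).
have t01 : t0 + 2 * pi <= t1.
  move: ht1; rewrite ltr_pdivrMr// (mulrC (p t1)) => ht1.
  rewrite leNgt; apply/negP => t1lt.
  have : c * expR (2 * k%:R * a * t1) <= c * expR (2 * k%:R * a * (t0 + 2 * pi)).
    by rewrite ler_pM2l// ler_expR ler_pM2l// ltW.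
  by rewrite -hc//; lra.
have [u1 [u2 [J1 J2 X12]]] := inversion_nonconstant _ _ Jt0 Jt1 t01.
(* From [p >= m] follows [1 + a * p <= (m^-1 + a) * p], that is, [p^-1 <= C0 / E] for the
   exponential [E] below. *)
pose C0 := (m^-1 + a) / c; have C00 : 0 < C0 by rewrite divr_gt0// addr_gt0// invr_gt0.
pose tm := ln c^-1 / (2 * k%:R * a).
apply: (@curve_dim_one _ inv_x inv_y _ _ J L (C0 `^ al * expR (2 * a * `|tm|)) a 0 u1 u2
  trajectory_interval is_derive_inv_x is_derive_inv_y) => //.
- by move=> t /hL[].
- by move=> t /hL[].
- by rewrite mulr_ge0 ?powR_ge0 ?expR_ge0.
move=> t Jt; exists 0; first by left.
exists (t + psi); have [hx hy] := hpsi t Jt.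
rewrite (edist_inversion psi 0 t hx hy) subr0 ger0_norm ?powR_ge0//.
have p0 := powrad_gt0 t Jt; have pm := hm t Jt.
set E := expR (2 * k%:R * a * t); have E0 : 0 < E by exact: expR_gt0.
have hct := hc t Jt; rewrite -/E in hct.
have ptm : tm <= t.
  rewrite /tm ler_pdivrMr// mulrC -ler_expR lnK ?posrE ?invr_gt0// -/E.
  rewrite -[leLHS]mul1r ler_pdivrMr// mulrC -hct lerDl mulr_ge0// ltW//.
apply: (@le_trans _ _ ((C0 / E) `^ al)).
  apply: powRV_le => //.
  rewrite /C0 -mulrA -invfM -hct ler_pdivlMr; last by rewrite addr_gt0// mulr_gt0.
  rewrite mulrDr mulr1 mulrCA mulVf ?gt_eqF// mulr1 lerD2r.
  by rewrite lef_pV2 ?posrE.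
rewrite powRM ?(ltW C00) ?invr_ge0 ?(ltW E0)// -mulrA ler_pM2l ?powR_gt0//.
rewrite /E -expRN (_ : - (2 * k%:R * a * t) = 2 * k%:R * (- (a * t))); last by ring.
rewrite expR_exponent -expRD ler_expR.
(* As [t >= tm], |t| is at most [t] plus twice |tm|; this is the origin of the factor with |tm| in
   the constant. *)
have -> : 2 * a * `|tm| + - (a * `|t|) = a * (2 * `|tm| - `|t|) by ring.
rewrite -mulrN ler_pM2l//.
have := ler_norm (- tm); rewrite normrN; have := normr_ge0 tm.
by case: (ler0P t) => t_sign; lra.
Qed.

(** Unboundedness gives [be * p > 1] at some time, hence [d > 0], and the trajectory stays outside
    the circle [p = 1 / be]. After inversion it approaches the origin backward in time and the
    circle of radius [R0] forward in time. *)
Lemma dim_one_contracting : a < 0 ->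
  upper_box_dim [set (inv_x t, inv_y t) | t in J] = 1%:E /\
  lower_box_dim [set (inv_x t, inv_y t) | t in J] = 1%:E.
Proof.
move=> a0; have [c hc] := first_integral.
have [psi hpsi] := inversion_polar; have [L hL] := inversion_speed_bounded.
pose be := - a; have be0 : 0 < be by rewrite oppr_gt0.
have k1 : 1 <= k%:R :> R by rewrite ler1n.
have lam0 : 0 < 2 * k%:R * be by rewrite !mulr_gt0//; lra.
have [t0 Jt0 ht0] := powrad_unbounded be^-1.
pose d := - c.
have hd t : J t -> be * p t - 1 = d * expR (2 * k%:R * be * - t).
  move=> Jt; have := hc t Jt.
  have -> : 2 * k%:R * be * - t = 2 * k%:R * a * t by rewrite /be; ring.
  by rewrite /d /be; lra.
have d0 : 0 < d.
  have : 0 < d * expR (2 * k%:R * be * - t0).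
    rewrite -hd// subr_gt0; move: ht0.
    by rewrite -[be^-1]mul1r ltr_pdivrMr// mulrC.
  by rewrite pmulr_lgt0// expR_gt0.
have [t1 Jt1 ht1] :=
  powrad_unbounded ((1 + d * expR (2 * k%:R * be * - (t0 - 2 * pi))) / be).
have t01 : t1 + 2 * pi <= t0.
  move: ht1; rewrite ltr_pdivrMr// (mulrC (p t1)) => ht1.
  rewrite leNgt; apply/negP => t1lt.
  have : d * expR (2 * k%:R * be * - t1) <= d * expR (2 * k%:R * be * - (t0 - 2 * pi)).
    by rewrite ler_pM2l// ler_expR ler_pM2l//; lra.
  by rewrite -hd//; lra.
have [u1 [u2 [J1 J2 X12]]] := inversion_nonconstant _ _ Jt1 Jt0 t01.
have P00 : 0 < be^-1 by rewrite invr_gt0.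
pose R0 := be^-1 `^ (- al).
(* [C1] serves [t <= 0], where [p >= d * E / be]. [C2] serves [t > 0]: it is the absolute slope of
   the power [- al] at the limit value [1 / be], times the amplitude of [p - 1 / be]. *)
pose C1 := (be / d) `^ al; pose C2 := profile_slope al 1 be^-1 * (d / be).
have C10 : 0 < C1 by rewrite powR_gt0// divr_gt0.
have D0 : 0 < profile_slope al 1 be^-1 by apply: profile_slope_gt0 => //; exact: exponent_gt0.
have C20 : 0 < C2 by rewrite mulr_gt0// divr_gt0.
apply: (@curve_dim_one _ inv_x inv_y _ _ J L (C1 + C2) be R0 u1 u2
  trajectory_interval is_derive_inv_x is_derive_inv_y) => //.
- by move=> t /hL[].
- by move=> t /hL[].
- exact: powR_ge0.
- by rewrite addr_ge0// ltW.
move=> t Jt; have [hx hy] := hpsi t Jt; have p0 := powrad_gt0 t Jt.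
have := hd t Jt; set E := expR _ => hE; have E0 : 0 < E by exact: expR_gt0.
have e0 := expR_gt0 (- (be * `|t|)).
have [t_le|t_gt] := ler0P t.
  exists 0; first by left.
  exists (t + psi); rewrite (edist_inversion psi 0 t hx hy) subr0 ger0_norm ?powR_ge0//.
  apply: (@le_trans _ _ ((be / d * E^-1) `^ al)).
    apply: powRV_le => //.
    have -> : be / d * E^-1 = (d * E / be)^-1 by rewrite invf_div invfM; ring.
    rewrite lef_pV2 ?posrE//; last by rewrite divr_gt0// mulr_gt0.
    by rewrite ler_pdivrMr// mulrC; lra.
  rewrite powRM ?invr_ge0 ?(ltW E0)//; last by rewrite ltW// divr_gt0.
  rewrite /E -expRN (_ : - (2 * k%:R * be * - t) = 2 * k%:R * (be * t)); last by ring.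
  rewrite expR_exponent mulrN opprK -/C1.
  by rewrite ler_pM2r ?expR_gt0// lerDl ltW.
exists R0; first by right.
exists (t + psi); rewrite (edist_inversion psi R0 t hx hy).
have pE : p t - be^-1 = d / be * E.
  by rewrite mulrAC -hE; field; rewrite gt_eqF.
have pbe : be^-1 <= p t.
  by rewrite -subr_ge0 pE mulr_ge0 ?(ltW E0)// ltW// divr_gt0.
have al0 := exponent_gt0.
have /andP[_ hs] := profile_sub al 1 al0 ltr01 _ _ P00 pbe.
rewrite distrC ger0_norm ?subr_ge0 ?powRN_le ?(ltW al0)//.
move: hs; rewrite /profile !mul1r pE mulrA -/C2 => /le_trans; apply.
apply: (@le_trans _ _ (C2 * expR (- (be * t)))).
  rewrite ler_pM2l// /E ler_expR mulrN lerN2 ler_pM2r// ler_peMl ?(ltW be0)//; lra.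
by rewrite ler_pM2r ?expR_gt0// lerDr ltW.
Qed.

(** Here [p = 2 * k * (t + c)], so [t + c] is the spiral parameter and [c] is compensated in the
    phase. The lower bound on [p] makes [inf J'] positive and its unboundedness makes [J'] unbounded
    above; the two inclusions leave open whether [inf J'] belongs to [J']. *)
Lemma spiral_neutral : a = 0 ->
  exists b psi J' s0, [/\ 0 < b, 0 < s0, (forall s, s0 < s -> J' s),
    (forall s, J' s -> s0 <= s) &
    [set (inv_x t, inv_y t) | t in J] = spiral al b psi J'].
Proof.
move=> a0; have [psi hpsi] := inversion_polar.
have [m m0 hm] := powrad_bounded_below.
have [t0 Jt0 _] := powrad_unbounded 0.
have k2 : 0 < 2 * k%:R :> R by rewrite mulr_gt0// ltr0n.
pose G t := p t + - (2 * k%:R) * t.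
have dG t : J t -> is_derive t 1 G 0.
  move=> Jt; have := is_derive_add _ _ _ _ _ (is_derive_powrad t Jt)
    (is_derive_scale _ _ _ (- (2 * k%:R)) (is_derive_id t 1)).
  by rewrite (_ : _ + _ = 0)// a0; ring.
pose c := G t0 / (2 * k%:R).
have pE t : J t -> p t = 2 * k%:R * (t + c).
  move=> Jt; have : G t = 2 * k%:R * c.
    rewrite (interval_cst J G trajectory_interval dG t t0 Jt Jt0) /c.
    by rewrite [RHS]mulrC divfK// gt_eqF.
  by rewrite /G; lra.
pose J' := [set s | J (s - c)].
have lbJ' : lbound J' (m / (2 * k%:R)).
  move=> s Js; rewrite ler_pdivrMr// mulrC (le_trans (hm _ Js))//.
  by rewrite (pE _ Js) subrK.
have J'0 : J' !=set0 by exists (t0 + c); rewrite /J'/= addrK.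
exists ((2 * k%:R) `^ (- al)), (psi - c), J', (inf J'); split.
- exact: powR_gt0.
- by apply: lt_le_trans (lb_le_inf J'0 lbJ'); rewrite divr_gt0.
- move=> s infs; have [s1 Js1 s1s] := inf_lt J'0 infs.
  have [t Jt] := powrad_unbounded (2 * k%:R * s).
  rewrite pE// ltr_pM2l// => st.
  apply: (trajectory_interval (s1 - c) t) => //.
  by apply/andP; split; lra.
- by move=> s Js; apply: ge_inf => //; exists (m / (2 * k%:R)).
- have E t : J t -> p t `^ (- al) = (2 * k%:R) `^ (- al) * (t + c) `^ (- al).
    move=> Jt; rewrite pE// powRM ?(ltW k2)//.
    by have := powrad_gt0 t Jt; rewrite pE// pmulr_rgt0// => /ltW.
  have ang (t : R) : t + c + (psi - c) = t + psi by ring.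
  apply/seteqP; split=> [_ [t Jt <-]|_ [s Js <-]].
    have [-> ->] := hpsi t Jt; exists (t + c); first by rewrite /J'/= addrK.
    by rewrite ang E.
  exists (s - c) => //; have [-> ->] := hpsi _ Js.
  by rewrite E// -ang subrK.
Qed.

End trajectory.

Theorem theorem3p4 (R : realType) (k : nat) (a : R) (x y : R -> R) (J : set R) :
  (0 < k)%N ->
  unbounded_spiral_trajectory k a x y J ->
  let Gamma := [set (x t, y t) | t in J] in
  (a = 0 ->
     upper_box_dim_unb Gamma = ((4 * k)%:R / (2 * k + 1)%:R)%:E /\
     lower_box_dim_unb Gamma = ((4 * k)%:R / (2 * k + 1)%:R)%:E /\
     minkowski_measurable_unb Gamma) /\
  (a <> 0 ->
     upper_box_dim_unb Gamma = 1%:E /\ lower_box_dim_unb Gamma = 1%:E).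
Proof.
move=> k_gt0 traj Gamma.
rewrite /upper_box_dim_unb /lower_box_dim_unb /minkowski_measurable_unb inversion_image.
split=> [a0|/eqP].
  have [b [psi [J' [s0 [b0 s00 Js sJ ->]]]]] := spiral_neutral k a x y J k_gt0 traj a0.
  have -> : (4 * k)%:R / (2 * k + 1)%:R = 2 / (1 + (2 * k)%:R^-1) :> R.
    have kn : k%:R != 0 :> R by rewrite pnatr_eq0 -lt0n.
    have k1 : 2 * k%:R + 1 != 0 :> R by rewrite -natrM natr1 pnatr_eq0.
    by rewrite natrD !natrM; field; rewrite kn k1.
  exact: spiral_minkowski (exponent_gt0 k k_gt0) (exponent_lt1 k k_gt0) b0 J' s0 psi s00 Js sJ.
rewrite neq_lt => /orP[a0|a0].
  exact: (dim_one_contracting k a x y J k_gt0 traj a0).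
exact: (dim_one_expanding k a x y J k_gt0 traj a0).
Qed.
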